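(* Let $G$ be a finite group with identity element $e$ and let $\Omega=\{t\in G\mid t^2=e\}$. Then there is a bijection between the real $2$-blocks of $G$ that have defect zero and the projective components of $\mathcal{O}\Omega$.
   Context: Let $k$ be an algebraically closed field of characteristic $2$, and let $R$ be a complete discrete valuation ring of characteristic $0$ with residue field $R/J(R)=k$ and field of fractions $F$, where $F$ is a splitting field for all subgroups of the finite groups considered. $\mathcal{O}$ denotes either of the rings $k$ or $R$. Modules are right modules, finitely generated and free over $\mathcal{O}$. $\Omega$ is a $G$-set under conjugation, and $\mathcal{O}\Omega$ is the corresponding permutation $\mathcal{O}G$-module. A projective component of $\mathcal{O}\Omega$ is an indecomposable direct summand of $\mathcal{O}\Omega$ that is also a direct summand of a free $\mathcal{O}G$-module; projective components are the projective terms in a decomposition of $\mathcal{O}\Omega$ into indecomposables (determined up to isomorphism by the Krull-Schmidt theorem). A block of $\mathcal{O}G$ (a $2$-block of $G$) is an indecomposable $\mathcal{O}$-algebra direct summand $B$ of $\mathcal{O}G$. For $\mathcal{O}=k$ it has defect zero if it is a simple $k$-algebra; for $\mathcal{O}=R$ it has defect zero if $k\otimes_R B$ is a simple $k$-algebra (equivalently, in both cases, its defect groups are trivial). Put $B^o=\{x^\sigma\mid x\in B\}$, where $\sigma$ is the $\mathcal{O}$-linear map on $\mathcal{O}G$ with $g^\sigma=g^{-1}$ for $g\in G$; $B$ is real if $B=B^o$ (equivalently, the set of ordinary irreducible characters of the block is closed under complex conjugation). *)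

(* Defs.v *)
From HB Require Import structures.
From mathcomp Require Import all_boot all_order all_algebra all_fingroup.
From mathcomp Require Import all_solvable all_field all_character.
From mathcomp Require Import boolp classical_sets functions.

Set Implicit Arguments.
Unset Strict Implicit.
Unset Printing Implicit Defensive.

Import GRing.Theory.

Local Open Scope classical_set_scope.
Local Open Scope ring_scope.

Section Modules.
Context {A : nzRingType}.
Implicit Types V W : lmodType A.

Definition submodule V (U : set V) : Prop := submod_closed [in U].

Definition dirsum V (U U1 U2 : set V) : Prop :=
  [/\ submodule U1, submodule U2, U1 `&` U2 = [set 0] &
      U = [set u1 + u2 | u1 in U1 & u2 in U2]].

Definition indecomposable V (U : set V) : Prop :=
  [/\ submodule U, U <> [set 0] &
      forall U1 U2, dirsum U U1 U2 -> U1 = [set 0] \/ U2 = [set 0]].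

Definition iso_submodules V W (U : set V) (U' : set W) : Prop :=
  exists2 f : V -> W, set_bij U U' f &
    forall a u v, U u -> U v -> f (a *: u + v) = a *: f u + f v.

(* Isomorphic to a direct summand of a free module of finite rank. *)
Definition projective V (U : set V) : Prop :=
  exists n (F F' : set 'rV[A]_n), dirsum setT F F' /\ iso_submodules U F.

(* V is the internal direct sum of the indecomposable submodules M i. *)
Definition indec_decomposition V (I : finType) (M : I -> set V) : Prop :=
  (forall i, indecomposable (M i)) /\
  (forall v, exists! x : {ffun I -> V},
     (forall i, M i (x i)) /\ v = \sum_i x i).

End Modules.

Section Algebras.
Context {O : comNzRingType} {A : algType O}.
Implicit Types B J : set A.

(* Two-sided ideals of a subalgebra B that need not contain the unit of A. *)
Definition ideal_in B J : Prop :=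
  [/\ J `<=` B, submodule J &
      forall b x, B b -> J x -> J (b * x) /\ J (x * b)].

Definition alg_dirsum B B1 B2 : Prop :=
  [/\ ideal_in B B1, ideal_in B B2 & dirsum B B1 B2].

Definition block B : Prop :=
  [/\ B <> [set 0], (exists C, alg_dirsum setT B C) &
      forall B1 B2, alg_dirsum B B1 B2 -> B1 = [set 0] \/ B2 = [set 0]].

(* Only applied to sets B that have their own unit element. *)
Definition simple_alg B : Prop :=
  B <> [set 0] /\ (forall J, ideal_in B J -> J = [set 0] \/ J = B).

End Algebras.

Definition galg (O : comNzRingType) (gT : finGroupType) : Type :=
  {ffun gT -> O}.

Section GroupAlgebra.
Variables (O : comNzRingType) (gT : finGroupType).
Local Notation A := (galg O gT).

HB.instance Definition _ := GRing.Lmodule.copy A {ffun gT -> O^o}.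

Definition galg_one : A := [ffun g => (g == 1%g)%:R].
Definition galg_mul (x y : A) : A :=
  [ffun g => \sum_h x h * y (h^-1 * g)%g].

Fact galg_mulA : associative galg_mul.
Proof.
move=> x y z; apply/ffunP=> g; rewrite !ffunE.
under eq_bigr do rewrite ffunE mulr_sumr.
under [RHS]eq_bigr do rewrite ffunE mulr_suml.
rewrite [RHS]exchange_big /=; apply: eq_bigr => h _.
rewrite (reindex_inj (mulgI h^-1)%g) /=; apply: eq_bigr => l _.
by rewrite mulrA invMg invgK -mulgA mulKVg.
Qed.

Fact galg_mul1 : left_id galg_one galg_mul.
Proof.
move=> x; apply/ffunP=> g; rewrite !ffunE (bigD1 1%g) //= ffunE eqxx mul1r.
rewrite invg1 mul1g big1 ?addr0 // => h /negbTE nh1.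
by rewrite ffunE nh1 mul0r.
Qed.

Fact galg_mulr1 : right_id galg_one galg_mul.
Proof.
move=> x; apply/ffunP=> g; rewrite !ffunE (bigD1 g) //= ffunE mulVg eqxx mulr1.
rewrite big1 ?addr0 // => h nhg.
by rewrite ffunE -eq_mulVg1 (negbTE nhg) mulr0.
Qed.

Fact galg_mulDl : left_distributive galg_mul +%R.
Proof.
move=> x y z; apply/ffunP=> g; rewrite !ffunE -big_split /=.
by apply: eq_bigr => h _; rewrite ffunE mulrDl.
Qed.

Fact galg_mulDr : right_distributive galg_mul +%R.
Proof.
move=> x y z; apply/ffunP=> g; rewrite !ffunE -big_split /=.
by apply: eq_bigr => h _; rewrite ffunE mulrDr.
Qed.

Fact galg_one_neq0 : galg_one != 0.
Proof.
by apply/eqP=> /ffunP/(_ 1%g); rewrite !ffunE eqxx; apply/eqP; apply: oner_neq0.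
Qed.

HB.instance Definition _ := GRing.Zmodule_isNzRing.Build A
  galg_mulA galg_mul1 galg_mulr1 galg_mulDl galg_mulDr galg_one_neq0.

Fact galg_scaleAl (a : O) (x y : A) : a *: (x * y) = (a *: x) * y.
Proof.
apply/ffunP=> g; rewrite !ffunE scaler_sumr.
by apply: eq_bigr => h _; rewrite ffunE scalerAl.
Qed.

HB.instance Definition _ := GRing.Lmodule_isLalgebra.Build O A galg_scaleAl.

Fact galg_scaleAr (a : O) (x y : A) : a *: (x * y) = x * (a *: y).
Proof.
apply/ffunP=> g; rewrite !ffunE scaler_sumr.
by apply: eq_bigr => h _; rewrite ffunE scalerAr.
Qed.

HB.instance Definition _ := GRing.Lalgebra_isAlgebra.Build O A galg_scaleAr.

(* The map sigma: g^sigma = g^-1. *)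
Definition galg_inv (x : A) : A := [ffun g => x g^-1%g].

Definition real_block (B : set A) : Prop := block B /\ galg_inv @` B = B.

End GroupAlgebra.

Definition galg_map (O O' : comNzRingType) (gT : finGroupType) (f : O -> O')
  (x : galg O gT) : galg O' gT := [ffun g => f (x g)].

Definition defect0_field (k : closedFieldType) (gT : finGroupType)
  (B : set (galg k gT)) : Prop := simple_alg B.

(* As B is a direct summand of RG, the k-algebra k (x)_R B is the image of B
   under coefficientwise reduction RG -> kG. *)
Definition defect0_lift (R : comNzRingType) (k : closedFieldType) (red : R -> k)
  (gT : finGroupType) (B : set (galg R gT)) : Prop :=
  simple_alg (galg_map red @` B).

(* The permutation module on T. Right OG-modules are left modules over the
   converse ring (OG)^c; v t is the coefficient of the basis element t in v,
   and t . g = to t g. *)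
Definition permmod (O : comNzRingType) (gT : finGroupType) (T : finType)
  (to : {action gT &-> T}) : Type := {ffun T -> O}.

Section PermutationModule.
Variables (O : comNzRingType) (gT : finGroupType) (T : finType).
Variable to : {action gT &-> T}.
Local Notation A := (galg O gT).
Local Notation M := (permmod O to).

HB.instance Definition _ := GRing.Zmodule.copy M {ffun T -> O}.

Definition permmod_scale (a : A^c) (v : M) : M :=
  [ffun t => \sum_g (a : A) g * v (to t g^-1%g)].

Fact permmod_scaleA a b v :
  permmod_scale a (permmod_scale b v) = permmod_scale (a * b) v.
Proof.
have -> : a * b = galg_mul (b : A) (a : A) :> A by [].
apply/ffunP=> t; rewrite !ffunE.
under eq_bigr do rewrite ffunE mulr_sumr.
under [RHS]eq_bigr do rewrite ffunE mulr_suml.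
rewrite exchange_big [RHS]exchange_big /=; apply: eq_bigr => h _.
rewrite [RHS](reindex_inj (mulgI h)) /=; apply: eq_bigr => l _.
by rewrite mulKg invMg actM mulrA [a l * _]mulrC.
Qed.

Fact permmod_scale1 : left_id 1 permmod_scale.
Proof.
move=> v; apply/ffunP=> t; rewrite ffunE (bigD1 1%g) //= ffunE eqxx mul1r.
rewrite invg1 act1 big1 ?addr0 // => h /negbTE nh1.
by rewrite ffunE nh1 mul0r.
Qed.

Fact permmod_scaleDr : right_distributive permmod_scale +%R.
Proof.
move=> a u v; apply/ffunP=> t; rewrite !ffunE -big_split /=.
by apply: eq_bigr => h _; rewrite ffunE mulrDr.
Qed.

Fact permmod_scaleDl v : {morph permmod_scale^~ v : a b / a + b}.
Proof.
move=> a b; apply/ffunP=> t; rewrite !ffunE -big_split /=.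
by apply: eq_bigr => h _; rewrite ffunE mulrDl.
Qed.

HB.instance Definition _ := GRing.Zmodule_isLmodule.Build A^c M
  permmod_scaleA permmod_scale1 permmod_scaleDr permmod_scaleDl.

End PermutationModule.

Section Omega.
Variable gT : finGroupType.

Definition Omega : Type := {t : gT | t ^+ 2 == 1}%g.
HB.instance Definition _ := Finite.on Omega.

Fact conj_Omega_subproof (t : Omega) (g : gT) : ((val t ^ g) ^+ 2 == 1)%g.
Proof. by rewrite -conjXg (eqP (valP t)) conj1g. Qed.

Definition conj_Omega (t : Omega) (g : gT) : Omega :=
  exist _ (val t ^ g)%g (conj_Omega_subproof t g).

Fact conj_Omega1 : conj_Omega^~ 1%g =1 id.
Proof. by move=> t; apply: val_inj; rewrite /= conjg1. Qed.

Fact conj_OmegaM t : act_morph conj_Omega t.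
Proof. by move=> a b; apply: val_inj; rewrite /= conjgM. Qed.

Definition Omega_action : {action gT &-> Omega} :=
  TotalAction conj_Omega1 conj_OmegaM.

End Omega.

(* A principal ideal domain that is local and not a field. *)
Definition is_dvr (R : idomainType) : Prop :=
  [/\ forall I : set R^o, submodule I -> exists a, I = [set x * a | x in setT],
      {in [predC GRing.unit] &, forall x y : R, x + y \isn't a GRing.unit} &
      exists2 x : R, x != 0 & x \isn't a GRing.unit].

(* Sequences that are Cauchy for the J(R)-adic topology converge; for R a
   discrete valuation ring with J(R) = (p), J(R)^n = (p^n). *)
Definition is_complete (R : idomainType) : Prop :=
  forall p : R, (forall x, (x \isn't a GRing.unit) <-> exists y, x = y * p) ->
  forall u : nat -> R,
  (forall n, exists N, forall i j, (N <= i)%N -> (N <= j)%N ->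
     exists y, u i - u j = y * p ^+ n) ->
  exists l, forall n, exists N, forall i, (N <= i)%N ->
     exists y, u i - l = y * p ^+ n.

(* Main.v *)
Require Import Defs.
From HB Require Import structures.
From mathcomp Require Import all_boot all_order all_algebra all_fingroup.
From mathcomp Require Import all_solvable all_field all_character.
From mathcomp Require Import boolp classical_sets functions.
Local Open Scope classical_set_scope.
Local Open Scope ring_scope.

Set Implicit Arguments.
Unset Strict Implicit.
Unset Printing Implicit Defensive.

Import GRing.Theory.

(** The endomorphism ring of the module on [Omega] is the ring of matrices
    indexed by [Omega] that are invariant under conjugation. A direct summand is
    projective when the idempotent [X] projecting on it is a relative trace
    [mxtr f], the sum of the conjugates of some matrix [f]
    ([projective_mx_image], [mxtr_projective]).

    Over [k] everything rests on the matrices [rho z], with entries [z (s * t)]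
    for [s] and [t] in [Omega]. Let sigma be the anti-automorphism [galg_inv].
    The elements fixed by sigma, modulo the elements [x + galg_inv x], form a
    space with basis [Omega] since the characteristic is 2, and the central
    elements fixed by sigma act on it by multiplication; their matrices are the
    [rho z]. Hence [rho] is multiplicative on these elements ([rhoM]) and kills
    [z + galg_inv z] ([rho_inv]). The key fact is [mxtr_rho]: each relative
    trace of matrices is [rho z] for some [z], fixed by sigma, that is itself
    a relative trace [trG x] from the group algebra. So the relative traces of
    matrices commute with each other.

    If a primitive idempotent [X] is a relative trace, then [X = rho z], and
    Fitting's lemma for [z] produces central idempotents fixed by sigma that
    act as the identity on [X]. One of least rank is the unit [e] of a block:
    it cannot split further, neither into real idempotents, since [X] is
    primitive, nor into a conjugate pair, since such a pair acts as zero. As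
    [e] is a multiple of a trace, the block is a simple algebra
    ([trG_simple]), so that its center is [k] and [X = rho e]
    ([prim_mxtr_rho]).

    Conversely let [e] be the unit of a real simple block. Then [e] is a trace
    ([simple_trG]), and so is [rho e] ([rho_mxtr]); a rank one argument shows
    [rho e <> 0] ([rho_neq0]); and since multiplying [rho e] by an endomorphism
    gives [rho] of an element of the center [k] of the block, [rho e] equals
    each primitive idempotent that it does not annihilate
    ([rho_simple_prim]). So the projective summands of any decomposition
    correspond to the units [e].

    Over [R], idempotents of the group algebra and of the endomorphism ring
    lift from [k] by completeness ([dvr_idem_lift]), primitive idempotents stay
    primitive under reduction, and being a relative trace can be tested over
    [k] ([mxtr_red_lift]), so both sides are the same over [R] and over [k].
    The case of [k] itself is treated at the same time, with the identity as
    reduction map ([real_defect0_bij]). *)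

(** * Matrices indexed by a finite type *)

Section IndexedMatrix.
Variables (O : comNzRingType) (T : finType).
Implicit Types (X Y : 'M[O]_#|T|) (f : T -> T -> O).

Definition fun_mx f : 'M[O]_#|T| :=
  \matrix_(i, j) f (enum_val i) (enum_val j).
Definition ent X s t : O := X (enum_rank s) (enum_rank t).

Lemma ent_fun_mx f s t : ent (fun_mx f) s t = f s t.
Proof. by rewrite /ent mxE !enum_rankK. Qed.

Lemma entP X Y : (forall s t, ent X s t = ent Y s t) -> X = Y.
Proof.
move=> eqXY; apply/matrixP=> i j.
by have := eqXY (enum_val i) (enum_val j); rewrite /ent !enum_valK.
Qed.

Lemma sum_enum_val (F : T -> O) :
  \sum_(i < #|T|) F (enum_val i) = \sum_t F t.
Proof.
rewrite [RHS](reindex (@enum_val T predT)) //=.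
by exists enum_rank => x _; rewrite ?enum_rankK ?enum_valK.
Qed.

Lemma entM X Y s t : ent (X * Y) s t = \sum_u ent X s u * ent Y u t.
Proof.
rewrite /ent mxE -sum_enum_val.
by apply: eq_bigr => i _; rewrite enum_valK.
Qed.

Lemma mx_scalerAl a X Y : a *: X * Y = a *: (X * Y).
Proof. by rewrite /GRing.mul /= scalemxAl. Qed.
Lemma mx_scalerAr a X Y : X * (a *: Y) = a *: (X * Y).
Proof. by rewrite /GRing.mul /= scalemxAr. Qed.

Lemma ent0 s t : ent 0 s t = 0. Proof. by rewrite /ent mxE. Qed.
Lemma entD X Y s t : ent (X + Y) s t = ent X s t + ent Y s t.
Proof. by rewrite /ent mxE. Qed.
Lemma entN X s t : ent (- X) s t = - ent X s t.
Proof. by rewrite /ent mxE. Qed.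
Lemma entZ a X s t : ent (a *: X) s t = a * ent X s t.
Proof. by rewrite /ent mxE. Qed.
Lemma ent_sum (I : finType) (X : I -> 'M[O]_#|T|) s t :
  ent (\sum_i X i) s t = \sum_i ent (X i) s t.
Proof. by rewrite /ent summxE. Qed.

Lemma tr_entE X : \tr X = \sum_t ent X t t.
Proof.
rewrite /mxtrace -sum_enum_val; apply: eq_bigr => i _.
by rewrite /ent enum_valK.
Qed.
End IndexedMatrix.

(** The nonfixed points of an involution come in pairs, whose two terms
    cancel. *)
Lemma sum_involution_pchar2 (k : nzRingType) (k2 : 2%N \in [pchar k])
    (T : finType) (i : T -> T) (F : T -> k) :
    involutive i -> (forall x, F (i x) = F x) ->
  \sum_x F x = \sum_(x | i x == x) F x.
Proof.
move=> iK Fi; rewrite (bigID (fun x => i x == x)) /=.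
set S := (X in _ + X); suff -> : S = 0 by rewrite addr0.
rewrite /S (bigID (fun x => enum_rank x < enum_rank (i x))%N) /=.
rewrite [X in _ + X](reindex_inj (inv_inj iK)) /= addrC.
rewrite (eq_bigl (fun x => (i x != x) && (enum_rank x < enum_rank (i x))%N)).
  by rewrite (eq_bigr F) ?(addrr_pchar2 k2) // => x _; rewrite Fi.
move=> x /=; rewrite !iK eq_sym; case: eqVneq => //= nix; rewrite -leqNgt.
by rewrite leq_eqVlt (inj_eq val_inj) (inj_eq enum_rank_inj) eq_sym (negPf nix).
Qed.

(** In a full rank factorisation [C *m R] of a square-zero matrix, [R *m C] is
    zero, and it has the same trace. *)
Lemma mxtrace_sq0 (k : fieldType) n (X : 'M[k]_n) : X *m X = 0 -> \tr X = 0.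
Proof.
move=> X2; rewrite -(mulmx_base X) mxtrace_mulC.
suff -> : row_base X *m col_base X = 0 by rewrite mxtrace0.
have XX := mulmx_base X; move: XX (col_base_full X) (row_base_free X).
move: (col_base X) (row_base X) => C R XCR fullC freeR.
apply: (row_full_inj fullC); apply: (row_free_inj freeR).
by rewrite mulmx0 mul0mx !mulmxA XCR -mulmxA XCR.
Qed.

(** An idempotent that vanishes modulo the radical is killed by the invertible
    matrix 1 - X. *)
Lemma idem_mx_red0 (O k : comUnitRingType) (red : {rmorphism O -> k})
    (red_unit : forall x, red x \is a GRing.unit -> x \is a GRing.unit)
    n (X : 'M[O]_n) :
  X *m X = X -> map_mx red X = 0 -> X = 0.
Proof.
move=> XX rX; have u1X : 1%:M - X \in unitmx.
  rewrite unitmxE; apply: red_unit; rewrite -det_map_mx map_mxB rX subr0.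
  by rewrite map_mx1 det1 unitr1.
apply: (can_inj (mulKmx u1X)); rewrite mulmx0 mulmxBl mul1mx XX subrr.
by [].
Qed.

(** * Elements of the group algebra *)

Lemma submoduleE (A : nzRingType) (V : lmodType A) (U : set V) :
  submodule U <-> U 0 /\ forall a u v, U u -> U v -> U (a *: u + v).
Proof.
split=> -[U0 UL]; split; first by move: U0; rewrite inE.
- by move=> a u v Uu Uv; have := UL a u v; rewrite !inE; apply.
- by rewrite inE.
by move=> a u v; rewrite !inE; apply: UL.
Qed.

Section GroupAlgebraTheory.
Variables (O : comNzRingType) (gT : finGroupType).
Local Notation A := (galg O gT).
Implicit Types x y z a : A.

Definition delta (g : gT) : A := [ffun h => (h == g)%:R].

(** Multiplication by [x] on the right. *)
Definition reg x : 'M[O]_#|gT| := fun_mx (fun s t => x (s^-1 * t)%g).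

Definition central z := forall a, z * a = a * z.

(** The relative trace from the trivial subgroup for the conjugation
    action. *)
Definition trG x : A := [ffun g => \sum_h x (g ^ h)%g].

Lemma galgME x y g : (x * y) g = \sum_h x h * y (h^-1 * g)%g.
Proof. exact: ffunE. Qed.

Lemma galgDE x y g : (x + y) g = x g + y g. Proof. exact: ffunE. Qed.
Lemma galgNE x g : (- x) g = - x g. Proof. exact: ffunE. Qed.
Lemma galg0E g : (0 : A) g = 0. Proof. exact: ffunE. Qed.
Lemma galg1E g : (1 : A) g = (g == 1%g)%:R. Proof. exact: ffunE. Qed.
Lemma galgZE (c : O) x g : (c *: x) g = c * x g. Proof. exact: ffunE. Qed.
Lemma galg_sumE (I : finType) (F : I -> A) g : (\sum_i F i) g = \sum_i F i g.
Proof. exact: sum_ffunE. Qed.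

Lemma deltaMl g x h : (delta g * x) h = x (g^-1 * h)%g.
Proof.
rewrite galgME (bigD1 g) //= ffunE eqxx mul1r big1 ?addr0 // => l /negPf nlg.
by rewrite ffunE nlg mul0r.
Qed.

Lemma deltaMr g x h : (x * delta g) h = x (h * g^-1)%g.
Proof.
rewrite galgME (bigD1 (h * g^-1)%g) //= big1 => [|l nl].
  by rewrite addr0 ffunE invMg invgK mulgKV eqxx mulr1.
rewrite ffunE [_ == g](_ : _ = false) ?mulr0 //; apply: contraNF nl.
by move=> /eqP <-; rewrite invMg invgK mulKVg.
Qed.

Lemma galg_sum_delta x : x = \sum_g x g *: delta g.
Proof.
apply/ffunP=> h; rewrite galg_sumE (bigD1 h) //= galgZE ffunE eqxx mulr1.
rewrite big1 ?addr0 // => g /negPf ngh.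
by rewrite galgZE ffunE eq_sym ngh mulr0.
Qed.

Lemma centralP z : central z <-> forall g h, z (g ^ h)%g = z g.
Proof.
split=> [cz g h | cz a].
  have /ffunP/(_ (h * (g ^ h))%g) := cz (delta h).
  by rewrite deltaMr deltaMl mulKg conjgE mulKVg mulgK => <-.
apply/ffunP=> g; rewrite !galgME (reindex_inj invg_inj) /=.
rewrite (reindex_inj (mulIg g^-1%g)) /=; apply: eq_bigr => h _.
rewrite !invgK invMg invgK mulgKV mulrC -(cz (h^-1 * g)%g g^-1%g).
by rewrite conjgE invgK mulgK.
Qed.

Lemma central1 : central 1. Proof. by move=> a; rewrite mul1r mulr1. Qed.
Lemma centralB x y : central x -> central y -> central (x - y).
Proof. by move=> cx cy a; rewrite mulrBl mulrBr cx cy. Qed.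
Lemma centralD x y : central x -> central y -> central (x + y).
Proof. by move=> cx cy a; rewrite mulrDl mulrDr cx cy. Qed.
Lemma centralM x y : central x -> central y -> central (x * y).
Proof. by move=> cx cy a; rewrite -mulrA cy mulrA cx mulrA. Qed.
Lemma centralX x n : central x -> central (x ^+ n).
Proof.
move=> cx; elim: n => [|n IHn]; first exact: central1.
by rewrite exprS; exact: centralM.
Qed.
Lemma centralZ (c : O) x : central x -> central (c *: x).
Proof. by move=> cx a; rewrite -scalerAl cx scalerAr. Qed.

Lemma regM x y : reg (x * y) = reg x * reg y.
Proof.
apply: entP => s t; rewrite entM ent_fun_mx galgME (reindex_inj (mulgI s^-1%g)).
by apply: eq_bigr => u _; rewrite /= !ent_fun_mx invMg invgK mulgA mulgK.
Qed.

Lemma regB x y : reg (x - y) = reg x - reg y.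
Proof.
by apply: entP => s t; rewrite entD entN !ent_fun_mx galgDE galgNE.
Qed.

Lemma regZ c x : reg (c *: x) = c *: reg x.
Proof. by apply: entP => s t; rewrite entZ !ent_fun_mx galgZE. Qed.

Lemma ent_reg1 x t : ent (reg x) 1%g t = x t.
Proof. by rewrite ent_fun_mx invg1 mul1g. Qed.

Lemma reg_inj : injective reg.
Proof. by move=> x y eqr; apply/ffunP=> t; rewrite -!ent_reg1 eqr. Qed.

Lemma reg0 : reg 0 = 0.
Proof. by apply: entP => s t; rewrite ent_fun_mx galg0E ent0. Qed.

(** The row of [reg x] at the identity is [x] itself, so that a factorisation
    of matrices descends to the group algebra. *)
Lemma reg_factor (D : 'M[O]_#|gT|) x y :
  reg x = D * reg y -> exists d, x = d * y.
Proof.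
move=> eqx; exists [ffun s => ent D 1%g s]; apply/ffunP=> t.
rewrite -ent_reg1 eqx entM galgME; apply: eq_bigr => u _.
by rewrite ent_fun_mx ffunE.
Qed.

Lemma galg_invK : involutive (@galg_inv O gT).
Proof. by move=> x; apply/ffunP=> g; rewrite !ffunE invgK. Qed.

Lemma galg_invM x y : galg_inv (x * y) = galg_inv y * galg_inv x.
Proof.
apply/ffunP=> g; rewrite ffunE !galgME (reindex_inj (mulgI g^-1)%g).
by apply: eq_bigr => h _; rewrite !ffunE mulrC !invMg !invgK mulgK.
Qed.

Lemma galg_invB x y : galg_inv (x - y) = galg_inv x - galg_inv y.
Proof. by apply/ffunP=> g; rewrite !(ffunE, galgDE, galgNE). Qed.
Lemma galg_invD x y : galg_inv (x + y) = galg_inv x + galg_inv y.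
Proof. by apply/ffunP=> g; rewrite !(ffunE, galgDE). Qed.
Lemma galg_invZ c x : galg_inv (c *: x) = c *: galg_inv x.
Proof. by apply/ffunP=> g; rewrite !(ffunE, galgZE). Qed.

Lemma galg_invX x n : galg_inv (x ^+ n) = galg_inv x ^+ n.
Proof.
elim: n => [|n IHn]; first by apply/ffunP=> g; rewrite ffunE !galg1E eq_invg1.
by rewrite exprS galg_invM IHn -exprSr.
Qed.

Lemma central_inv z : central z -> central (galg_inv z).
Proof. by move=> cz a; rewrite -[a]galg_invK -!galg_invM cz. Qed.

Lemma galg_form_nondeg x : (forall a, (x * a) 1%g = 0) -> x = 0.
Proof.
move=> x0; apply/ffunP=> g; have := x0 (delta g^-1%g).
by rewrite deltaMr mul1g invgK galg0E.
Qed.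

Lemma galg_formC x y : (x * y) 1%g = (y * x) 1%g.
Proof.
rewrite !galgME (reindex_inj invg_inj) /=.
by apply: eq_bigr => h _; rewrite !mulg1 invgK mulrC.
Qed.

Lemma trG_central x : central (trG x).
Proof.
apply/centralP=> g h; rewrite !ffunE (reindex_inj (mulgI h^-1)%g) /=.
by apply: eq_bigr => l _; rewrite -conjgM mulKVg.
Qed.

Lemma trGMr x z : central z -> trG x * z = trG (x * z).
Proof.
move=> /centralP cz; apply/ffunP=> g; rewrite galgME ffunE.
under [LHS]eq_bigr do rewrite ffunE mulr_suml.
rewrite exchange_big /=; apply: eq_bigr => h _.
rewrite galgME [RHS](reindex_inj (conjg_inj h)) /=; apply: eq_bigr => l _.
by rewrite -(cz _ h) conjMg conjVg.
Qed.

Lemma trGZ c x : trG (c *: x) = c *: trG x.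
Proof.
apply/ffunP=> g; rewrite galgZE !ffunE mulr_sumr.
by apply: eq_bigr => h _; rewrite galgZE.
Qed.

(** Both sides are the trace of the operator sending [b] to [x * b * y]. *)
Lemma trG_form x y : (x * trG y) 1%g = \sum_g (x * delta g * y) g.
Proof.
rewrite galgME; under eq_bigr do rewrite ffunE mulr_sumr.
rewrite exchange_big /=; apply: eq_bigr => g _; rewrite galgME.
rewrite [RHS](reindex_inj (mulIg g)) /=; apply: eq_bigr => l _.
by rewrite deltaMr mulgK mulg1 invMg conjgE mulgA.
Qed.

Lemma trG_formC x y : (trG x * y) 1%g = (x * trG y) 1%g.
Proof.
rewrite !galgME; under eq_bigr do rewrite ffunE mulr_suml.
under [RHS]eq_bigr do rewrite ffunE mulr_sumr.
rewrite exchange_big [RHS]exchange_big /= (reindex_inj invg_inj) /=.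
apply: eq_bigr => h _; rewrite (reindex_inj (conjg_inj h)) /=.
by apply: eq_bigr => l _; rewrite conjgK !mulg1 -conjVg.
Qed.
End GroupAlgebraTheory.

Section Pairs.
Variables (k : comNzRingType) (gT : finGroupType).
Hypothesis k2 : 2%N \in [pchar k].

Lemma sum_Omega (F : gT -> k) :
  (forall u, F u^-1%g = F u) -> \sum_u F u = \sum_(u : Omega gT) F (val u).
Proof.
move=> Fi; rewrite (sum_involution_pchar2 k2 (@invgK gT)) //.
transitivity (\sum_(u in [pred u : gT | u ^+ 2 == 1]%g) F u); last first.
  exact: big_sub.
apply: eq_bigl => u; by rewrite inE expgS expg1 -eq_invg_mul.
Qed.
End Pairs.

(** * Rank one elements *)

Section RankOne.
Variables (k : closedFieldType) (gT : finGroupType).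
Local Notation A := (galg k gT).
Implicit Types (a b x y e w : A) (c : k).

(** In a matrix algebra these are the matrices of rank at most one. *)
Definition rank_one a := forall b, exists c : k, a * b * a = c *: a.

(** Minimality of the rank of the regular matrix makes [a] of rank one: the
    row space of [reg a] is stable under [reg (b * a)], so it contains an
    eigenvector, say for [c]; then [a * b * a - c *: a] has a bigger kernel
    than [a], hence vanishes. *)
Lemma ideal_rank_one (J : set A) x0 :
    (forall (c : k) u v, J u -> J v -> J (c *: u + v)) ->
    (forall b x, J x -> J (b * x) /\ J (x * b)) -> J x0 -> x0 != 0 ->
  exists a, [/\ J a, a != 0 & rank_one a].
Proof.
move=> JL JM Jx0 x0n0.
pose P r := `[< exists a, [/\ J a, a != 0 & \rank (reg a) = r] >].
have exP : exists r, P r by exists (\rank (reg x0)); apply/asboolP; exists x0.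
case: (ex_minnP exP) => r /asboolP[a [Ja an0 ra]] minr.
exists a; split=> // b; set X := reg a in ra.
have rgt0 : (0 < \rank X)%N.
  rewrite lt0n mxrank_eq0; apply: contraNneq an0 => X0.
  by apply/eqP/reg_inj; rewrite reg0.
have /submxP[D defD] : (row_base X *m (reg b *m X) <= row_base X)%MS.
  by rewrite mulmxA (submx_trans (submxMl _ _)) // eq_row_base.
have [c /eigenvalueP[v vD vn0]] : exists c, eigenvalue D c.
  have /closed_rootP[c rc] : size (char_poly D) != 1%N.
    by rewrite size_char_poly; case: (\rank X) rgt0.
  by exists c; rewrite eigenvalue_root_char.
exists c; apply/eqP; rewrite -subr_eq0; apply/negP=> /negP Zn0.
have /submxP[u defu] : (v *m row_base X <= X)%MS.
  by rewrite -(eq_row_base X) submxMl.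
have defZ : reg (a * b * a - c *: a) = X *m (reg b *m X - c%:M).
  by rewrite regB regZ !regM mulmxBr mul_mx_scalar -mulrA.
have sker : (kermx X <= kermx (reg (a * b * a - c *: a)))%MS.
  by apply/sub_kermxP; rewrite defZ mulmxA mulmx_ker mul0mx.
have uZ : (u <= kermx (reg (a * b * a - c *: a)))%MS.
  apply/sub_kermxP; rewrite defZ mulmxA -defu mulmxBr mul_mx_scalar.
  by rewrite -mulmxA defD mulmxA vD -scalemxAl subrr.
have nuX : ~~ (u <= kermx X)%MS.
  apply: contra vn0 => /sub_kermxP; rewrite -defu => /eqP.
  by rewrite mulmx_free_eq0 // row_base_free.
have : (\rank (kermx X) < \rank (kermx (reg (a * b * a - c *: a)%R)))%N.
  rewrite (ltn_leqif (mxrank_leqif_sup sker)).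
  by apply: contra nuX => /(submx_trans uZ).
have : (r <= \rank (reg (a * b * a - c *: a)%R))%N.
  apply: minr; apply/asboolP; exists (a * b * a - c *: a); split=> //.
  by rewrite addrC -scaleNr; apply: (JL _ _ _ Ja); have [] := JM (a * b) a Ja.
rewrite !mxrank_ker ra => le_r /leq_trans/(_ (leq_sub2l _ le_r)).
by rewrite ltnn.
Qed.

(** The trace of the projection [b |-> w * b * w] onto a line. *)
Lemma rank_one_trG w : w * w = w -> w != 0 -> rank_one w -> (w * trG w) 1%g = 1.
Proof.
move=> ww wn0 w1; have [c wc] : exists c : gT -> k,
    forall g, w * delta k g * w = c g *: w.
  by exists (fun g => projT1 (cid (w1 (delta k g)))) => g; case: cid.
have : w = (\sum_g c g * w g) *: w.
  rewrite -{1}ww -{1}ww {2}[w]galg_sum_delta mulr_sumr mulr_suml scaler_suml.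
  by apply: eq_bigr => g _; rewrite -scalerAr -scalerAl wc scalerA mulrC.
rewrite -{1}[w]scale1r => /eqP; rewrite -subr_eq0 -scalerBl scaler_eq0.
rewrite (negPf wn0) orbF subr_eq0 => /eqP ->; rewrite trG_form.
by apply: eq_bigr => g _; rewrite wc galgZE.
Qed.

(** Squaring [b |-> x * b * y] gives zero, so its trace vanishes. *)
Lemma trG_form_sq0 x y : y * y = 0 -> (trG x * y) 1%g = 0.
Proof.
move=> yy; rewrite trG_formC trG_form.
pose N : 'M_#|gT| := fun_mx (fun s t => (x * delta k s * y) t).
rewrite (_ : \sum_g _ = \tr N); last first.
  by rewrite tr_entE; apply: eq_bigr => g _; rewrite ent_fun_mx.
apply: mxtrace_sq0; apply: entP => s t; rewrite ent0.
transitivity ((x * (x * delta k s * y) * y) t); last first.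
  by rewrite -!mulrA yy !mulr0 galg0E.
rewrite [X in x * X * y]galg_sum_delta mulr_sumr mulr_suml galg_sumE.
rewrite (entM N N); apply: eq_bigr => u _.
by rewrite !ent_fun_mx -scalerAr -scalerAl galgZE.
Qed.
End RankOne.

(** * Blocks and central idempotents *)

Section Blocks.
Variables (O : comNzRingType) (gT : finGroupType).
Local Notation A := (galg O gT).
Implicit Types (e c x y a : A) (B : set A).

Definition corner e : set A := [set x | e * x = x].

Definition central_idem e := central e /\ e * e = e.

Definition block_idem e :=
  [/\ central_idem e, e != 0 &
      forall c, central_idem c -> e * c = c -> c = 0 \/ c = e].

Lemma central_idem1 : central_idem 1.
Proof. by split; [exact: central1|rewrite mulr1]. Qed.

Lemma central_idemM e c : central_idem e -> central_idem c -> central_idem (e * c).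
Proof.
move=> [ce ee] [cc ccc]; split; first exact: centralM.
by rewrite -mulrA [c * _]mulrA [c * e]cc -[e * c * c]mulrA ccc mulrA ee.
Qed.

Lemma central_idemB e c :
  central_idem e -> central_idem c -> e * c = c -> central_idem (e - c).
Proof.
move=> [ce ee] [cc ccc] ec; split; first exact: centralB.
by rewrite mulrBl !mulrBr ee ec ccc [c * e]cc ec subrr subr0.
Qed.

Lemma central_idem_inv e : central_idem e -> central_idem (galg_inv e).
Proof.
by move=> [ce ee]; split; [exact: central_inv|rewrite -galg_invM ee].
Qed.

Lemma corner1 : corner 1 = setT.
Proof. by apply/seteqP; split=> x //= _; rewrite /corner /= mul1r. Qed.

Lemma corner_submodule e : submodule (corner e).
Proof.
apply/submoduleE; split=> [|a u v]; rewrite /corner /= ?mulr0 // => eu ev.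
by rewrite mulrDr -scalerAr eu ev.
Qed.

(** A central idempotent is the unit element of its ideal. *)
Lemma corner_inj e c :
  central_idem e -> central_idem c -> corner e = corner c -> e = c.
Proof.
move=> [ce ee] [cc ccc] eqB; have : corner c e by rewrite -eqB.
have : corner e c by rewrite eqB.
by rewrite /corner /= => ec ce1; rewrite -ce1 -[RHS]ec ce.
Qed.

Lemma corner_dirsum e c : central_idem e -> central_idem c -> e * c = c ->
  alg_dirsum (corner e) (corner c) (corner (e - c)).
Proof.
move=> cie cic ec; have [[ce ee] [cc ccc]] := (cie, cic).
have id_c f : central_idem f -> e * f = f -> ideal_in (corner e) (corner f).
  move=> [cf ff] ef; split; [|exact: corner_submodule|].
    by move=> x /= fx; rewrite /corner /= -fx mulrA ef.
  move=> b x /= eb fx; rewrite /corner /=; split; last by rewrite mulrA fx.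
  by rewrite cf -mulrA -cf fx.
have eec : e * (e - c) = e - c by rewrite mulrBr ee ec.
split; [exact: id_c|by apply: id_c => //; apply: central_idemB|].
split; [exact: corner_submodule|exact: corner_submodule| |].
  apply/seteqP; split=> x /=; last by move=> ->; rewrite /corner /= !mulr0.
  move=> [cx]; rewrite /corner /= => <-; rewrite -cx mulrA mulrBl ccc ec subrr.
  by rewrite mul0r.
apply/seteqP; split=> x; rewrite /corner /=.
  move=> ex; exists (c * x); first by rewrite /= mulrA ccc.
  exists ((e - c) * x); last by rewrite -mulrDl addrC subrK.
  by have [_ idB] := central_idemB cie cic ec; rewrite /= mulrA idB.
move=> [y cy [z ez <-]]; rewrite mulrDr -cy mulrA ec; congr (_ + _).
by rewrite -ez mulrA eec.
Qed.

(** The components of the unit element generate the summands. *)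
Lemma alg_dirsum_corner e B1 B2 :
    central_idem e -> alg_dirsum (corner e) B1 B2 ->
  exists c, [/\ central_idem c, e * c = c, B1 = corner c & B2 = corner (e - c)].
Proof.
move=> [ce ee] [[s1 m1 i1] [s2 m2 i2] [_ _ i12 sum12]].
have idA (Bi : set A) : Bi `<=` corner e ->
    (forall b x, corner e b -> Bi x -> Bi (b * x) /\ Bi (x * b)) ->
    forall a x, Bi x -> Bi (a * x) /\ Bi (x * a).
  move=> sB iB a x Bx; have /= ex := sB x Bx.
  have [|l r] := iB (e * a) x _ Bx; first by rewrite /corner /= mulrA ee.
  by split; [rewrite -ex mulrA -ce|rewrite -ex ce -mulrA].
have {}i1 := idA _ s1 i1; have {}i2 := idA _ s2 i2.
have : corner e e by [].
rewrite sum12 => -[c B1c [d B2d cde]].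
have cap0 x : B1 x -> B2 x -> x = 0.
  by move=> B1x B2x; have : (B1 `&` B2) x by []; rewrite i12.
have c1 x : B1 x -> c * x = x.
  move=> B1x; have /= ex := s1 x B1x; rewrite -[RHS]ex -cde mulrDl.
  by rewrite [d * x]cap0 ?addr0 //; [have [] := i1 d x|have [] := i2 x d].
have c1' x : B1 x -> x * c = x.
  move=> B1x; have /= ex := s1 x B1x; rewrite -[RHS]ex ce -cde mulrDr.
  by rewrite [x * d]cap0 ?addr0 //; [have [] := i1 d x|have [] := i2 x d].
have d2 x : B2 x -> d * x = x.
  move=> B2x; have /= ex := s2 x B2x; rewrite -[RHS]ex -cde mulrDl.
  by rewrite [c * x]cap0 ?add0r //; [have [] := i1 x c|have [] := i2 c x].
have cc : central c.
  move=> a; transitivity (c * a * c); first by rewrite c1' //; have [] := i1 a c.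
  by rewrite -mulrA c1 //; have [] := i1 a c.
have defd : d = e - c by rewrite -cde addrAC subrr add0r.
exists c; split; [by split; last exact: c1|exact: s1| |].
  apply/seteqP; split=> x; rewrite /corner /=; first exact: c1.
  by move=> <-; have [] := i1 x c.
rewrite -defd; apply/seteqP; split=> x; rewrite /corner /=; first exact: d2.
by move=> <-; have [] := i2 x d.
Qed.

Lemma blockP B : block B <-> exists2 e, block_idem e & B = corner e.
Proof.
split=> [[Bn0 [C]]|[e [cie en0 prim_e] ->]].
  rewrite -corner1 => /(alg_dirsum_corner central_idem1)[e [cie _ defB _]] indB.
  exists e => //; split=> //.
    by apply/eqP=> e0; apply: Bn0; rewrite defB e0; apply/seteqP; split=> x;
      rewrite /corner /= ?mul0r // => ->.
  move=> c cic ec; have := corner_dirsum cie cic ec; rewrite -defB.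
  case/indB=> /seteqP[sub0 _].
    by left; apply: sub0; have [_] := cic.
  right; apply/esym/eqP; rewrite -subr_eq0; apply/eqP/sub0.
  by have [_] := central_idemB cie cic ec.
split.
- by apply/eqP; apply: contra en0 => /eqP/seteqP[+ _] => /(_ e)/(_ cie.2) /= ->.
- exists (corner (1 - e)); rewrite -corner1.
  by apply: corner_dirsum; rewrite ?mul1r //; exact: central_idem1.
move=> B1 B2 /(alg_dirsum_corner cie)[c [cic ec -> ->]].
have corner0 : corner 0 = [set 0].
  by apply/seteqP; split=> x; rewrite /corner /= ?mul0r // => ->.
by have [->|->] := prim_e c cic ec; [left|right; rewrite subrr].
Qed.

Lemma real_corner e :
  central_idem e -> (@galg_inv O gT @` corner e = corner e) <-> galg_inv e = e.
Proof.
move=> cie; have -> : @galg_inv O gT @` corner e = corner (galg_inv e).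
  have [ce ee] := cie; apply/seteqP; split=> x; rewrite /corner /=.
    by case=> y ey <-; rewrite (central_inv ce) -galg_invM ey.
  move=> ex; exists (galg_inv x); rewrite /= ?galg_invK //.
  by rewrite -[e]galg_invK -galg_invM -(central_inv ce) ex.
split=> [|->//]; apply: corner_inj => //; exact: central_idem_inv.
Qed.

Lemma block_idem_orth e c : block_idem e -> block_idem c -> e = c \/ e * c = 0.
Proof.
move=> [cie en0 prim_e] [cic cn0 prim_c]; have ciec := central_idemM cie cic.
have [ce ee] := cie; have [cc ccc] := cic.
have eec : e * (e * c) = e * c by rewrite mulrA ee.
have cec : c * (e * c) = e * c by rewrite cc -mulrA ccc.
have [|eqe] := prim_e _ ciec eec; first by right.
have [|eqc] := prim_c _ ciec cec; first by right.
by left; rewrite -{1}eqe.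
Qed.
End Blocks.

(** * Simple blocks and relative traces *)

Section SimpleBlocks.
Variables (k : closedFieldType) (gT : finGroupType).
Local Notation A := (galg k gT).
Implicit Types (a b d w x y z e : A) (c : k).

(** Fitting's lemma for multiplication by a central element [z]: once the rank
    of the powers [y] of [z] is stationary, [y = d * y ^+ 2] for some [d], and
    [d * y] is the unit of the ideal generated by [y]. *)
Lemma central_fitting z : central z ->
  exists e, [/\ central_idem e, exists d, e = z * d,
    exists m, e * z ^+ m.+1 = z ^+ m.+1 & galg_inv z = z -> galg_inv e = e].
Proof.
move=> cz; pose P r := `[< exists m, \rank (reg (z ^+ m.+1)) = r >].
have exP : exists r, P r.
  by exists (\rank (reg (z ^+ 1))); apply/asboolP; exists 0%N.
case: (ex_minnP exP) => r /asboolP[m rm] minr.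
set y : A := z ^+ m.+1 in rm; have cy : central y by exact: centralX.
have [d yd] : exists d, y = d * (y * y).
  have : (reg (y * y)%R <= reg y)%MS by rewrite regM submxMl.
  move/mxrank_leqif_sup => /geq_leqif; rewrite rm minr; last first.
    by apply/asboolP; exists (m.+1 + m)%N; rewrite -addnS exprD.
  by move=> /esym/submxP[D] /reg_factor.
have {}yd : d * y * y = y by rewrite -mulrA -yd.
have ye : y * (d * y) = y by rewrite cy.
have ce : central (d * y).
  move=> a; transitivity (d * y * a * (d * y)).
    by rewrite -[d * y * a]mulrA cy -!mulrA ye.
  by rewrite mulrA -(cy (d * y * a * d)) !mulrA cy yd -(cy (a * d)) mulrA.
have ee : d * y * (d * y) = d * y by rewrite -mulrA ye.
exists (d * y); split; first by split.
- by exists (z ^+ m * d); rewrite mulrA -exprS cy.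
- by exists m.
move=> sz; have sy : galg_inv y = y by rewrite galg_invX sz.
have cf := central_inv ce; have fy : galg_inv (d * y) * y = y.
  by rewrite -{2}sy -galg_invM ye.
have ef : d * y * galg_inv (d * y) = galg_inv (d * y).
  by rewrite galg_invM sy mulrA yd.
by rewrite -ef -cf mulrA cf -mulrA fy.
Qed.

Lemma rank_one_idem a b : rank_one a -> a * b * a != 0 ->
  exists c w, [/\ w = c *: (a * b), w * w = w, w != 0 & rank_one w].
Proof.
move=> a1 aba0; have [c abac] := a1 b.
have c0 : c != 0 by apply: contraNneq aba0 => c0; rewrite abac c0 scale0r.
exists c^-1; set w := c^-1 *: _; exists w; split=> //.
- rewrite /w -scalerAl -scalerAr mulrA abac -scalerAl !scalerA.
  by rewrite -mulrA mulVf // mulr1.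
- apply: contraNneq aba0 => w0.
  by rewrite -(scale1r (a * b)) -(divff c0) -scalerA -/w w0 scaler0 mul0r.
move=> x; have [c1 e1] := a1 (b * x); exists (c1 / c).
have e2 : a * b * x * (a * b) = c1 *: (a * b).
  by rewrite mulrA -(mulrA a b x) e1 -scalerAl.
by rewrite /w -!scalerAl -scalerAr e2 !scalerA mulrC mulrA.
Qed.

Section SimpleCorner.
Variable e : A.
Hypotheses (cie : central_idem e) (simple_e : simple_alg (corner e)).

Let corner_all (J : set A) x : ideal_in (corner e) J -> J x -> x != 0 -> J e.
Proof.
move=> iJ Jx xn0; have [_ /(_ J iJ)[J0|->]] := simple_e; last exact: cie.2.
by move: Jx xn0; rewrite J0 /= => ->; rewrite eqxx.
Qed.

Let e_neq0 : e != 0.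
Proof.
have [Bn0 _] := simple_e; apply: contra_notN Bn0 => /eqP ->.
by apply/seteqP; split=> x; rewrite /corner /= ?mul0r // => ->.
Qed.

(** The elements [b] with [a * x * b = 0] for all [x] form an ideal. *)
Lemma simple_prime a b :
  e * a = a -> e * b = b -> a != 0 -> b != 0 -> exists x, a * x * b != 0.
Proof.
have [ce ee] := cie; move=> ea eb an0 bn0; apply: contrapT => nx.
have ab0 x : a * x * b = 0.
  by apply: contrapT => /eqP abx; apply: nx; exists x.
pose J : set A := [set y | e * y = y /\ forall x, a * x * y = 0].
have [_ /(_ 1)] : J e.
  apply: (corner_all (x := b)) => //; split=> [y []//||y z /= ey [ez azx]].
    apply/submoduleE; split=> [|c u v [eu au] [ev av]].
      by split=> [|x]; rewrite mulr0.
    by split=> [|x]; rewrite mulrDr -scalerAr ?eu ?ev // au av scaler0 addr0.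
  split; split; rewrite ?mulrA ?ey ?ez // => x; last by rewrite mulrA azx mul0r.
  by rewrite mulrA -[a * x * y]mulrA azx.
by rewrite mulr1 -ce ea => /eqP; apply/negP.
Qed.

Lemma simple_rank_one : exists w, [/\ e * w = w, w * w = w, w != 0 & rank_one w].
Proof.
have [ce ee] := cie.
have [|b x ex|a [ea an0 a1]] := @ideal_rank_one k gT (corner e) e _ _ ee e_neq0.
- exact: (proj1 (submoduleE (corner e)) (corner_submodule e)).2.
- move: ex; rewrite /corner /= => ex.
  by split; rewrite mulrA ?ex // ce -mulrA ex.
have [b aba] := simple_prime ea ea an0 an0.
have [c [w [defw ww wn0 w1]]] := rank_one_idem a1 aba.
by exists w; split=> //; rewrite defw -scalerAr mulrA ea.
Qed.

(** A central element acts on the line fixed by a rank one idempotent as a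
    scalar, and the annihilator of the difference is an ideal. *)
Lemma simple_center z : central z -> e * z = z -> exists c, z = c *: e.
Proof.
move=> cz ez; have [w [ew ww wn0 w1]] := simple_rank_one; have [ce ee] := cie.
have [c wzw] := w1 z; exists c.
have czc : central (z - c *: e) by apply: centralB => //; exact: centralZ.
pose J : set A := [set y | e * y = y /\ (z - c *: e) * y = 0].
have [_] : J e.
  apply: (corner_all (x := w)) => //; last first.
    by split=> //; rewrite mulrBl -scalerAl ew -wzw -cz -mulrA ww subrr.
  split=> [y []//||y x /= ey [ex zx]].
    apply/submoduleE; split=> [|b u v [eu au] [ev av]]; first by rewrite /J /= !mulr0.
    by split; rewrite mulrDr -scalerAr ?eu ?ev // au av scaler0 addr0.
  split; split; rewrite mulrA ?ey ?ex ?zx ?mul0r //.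
  by rewrite czc -mulrA zx mulr0.
by rewrite mulrBl cz ez -scalerAl ee => /eqP; rewrite subr_eq0 => /eqP.
Qed.

(** The trace of a rank one idempotent lies in the center [k e], and it is not
    zero by [rank_one_trG]. *)
Lemma simple_trG : exists x, e = trG x.
Proof.
have [w [ew ww wn0 w1]] := simple_rank_one; have [ce ee] := cie.
have [||c tc] := @simple_center (trG w); first exact: trG_central.
  by rewrite ce trGMr // -ce ew.
have := rank_one_trG ww wn0 w1; rewrite tc -scalerAr galgZE => cw1.
have c0 : c != 0.
  by apply: contra_eqN cw1 => /eqP ->; rewrite mul0r eq_sym oner_eq0.
by exists (c^-1 *: w); rewrite trGZ tc scalerA mulVf // scale1r.
Qed.
End SimpleCorner.

Lemma trGE w : trG w = \sum_h delta k h * w * delta k h^-1%g.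
Proof.
apply/ffunP=> g; rewrite galg_sumE ffunE; apply: eq_bigr => h _.
by rewrite deltaMr deltaMl invgK conjgE.
Qed.

(** A nonzero ideal contains a rank one element [a]. As [e] is a multiple of a
    trace, the form would vanish on [a * A] if [a * A * a = 0]; so the ideal
    contains a rank one idempotent [w], whose trace is central and not
    nilpotent, and Fitting's lemma yields a nonzero central idempotent in the
    ideal. *)
Lemma trG_simple e x d :
  block_idem e -> e = trG x * d -> simple_alg (corner e).
Proof.
move=> [[ce ee] en0 prim_e] etr; split.
  by apply/eqP; apply: contra en0 => /eqP/seteqP[+ _] => /(_ e ee) /= ->.
move=> J [sJ /submoduleE[J0 JL] iJ].
have {}iJ b y : J y -> J (b * y) /\ J (y * b).
  move=> Jy; have /= ey := sJ y Jy.
  have [|l r] := iJ (e * b) y _ Jy; first by rewrite /corner /= mulrA ee.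
  by split; [rewrite -ey mulrA -ce|rewrite -ey ce -mulrA].
have [J00|/eqP] := pselect (J = [set 0]); first by left.
move=> Jn0; right; have [y [Jy yn0]] : exists y, J y /\ y != 0.
  apply: contrapT => ny; move/eqP: Jn0; apply; apply/seteqP; split=> y /=.
    by move=> Jy; apply: contrapT => /eqP yn0; apply: ny; exists y.
  by move=> ->.
have [a [Ja an0 a1]] := ideal_rank_one JL iJ Jy yn0.
have [b aba] : exists b, a * b * a != 0.
  apply: contrapT => nb; move/eqP: an0; apply; apply: galg_form_nondeg => b.
  have ab0 y' : a * y' * a = 0.
    by apply: contrapT => /eqP aby; apply: nb; exists y'.
  have /= ea := sJ a Ja; rewrite -ea etr -!mulrA; apply: trG_form_sq0.
  by rewrite -!mulrA [a * (b * _)]mulrA [a * b * _]mulrA [a * b * d * _]mulrA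
             -[a * b * d]mulrA ab0 mul0r mulr0.
have [c [w [defw ww wn0 w1]]] := rank_one_idem a1 aba.
have Jw : J w by rewrite defw -[_ *: _]addr0; apply: JL => //; have [] := iJ b a Ja.
have Jtr : J (trG w).
  rewrite trGE; elim/big_ind: _ => // [u v Ju Jv|h _].
    by rewrite -[u]scale1r; apply: JL.
  by have [_] := iJ (delta k h^-1%g) _ (iJ (delta k h) w Jw).1.
have cz : central (trG w) := @trG_central _ _ w.
have [e0 [[ce0 ee0] [d0 e0d] [m e0z] _]] := central_fitting cz.
have Je0 : J e0 by rewrite e0d; have [] := iJ d0 _ Jtr.
have e0n0 : e0 != 0.
  apply/negP=> /eqP e00; case/negP: (wn0).
  have [c1 wzw] := w1 (trG w).
  have zw : trG w * w = c1 *: w by rewrite -wzw -cz -mulrA ww.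
  have c1n0 : c1 != 0.
    apply: contra_eqN (rank_one_trG ww wn0 w1) => /eqP c10.
    by rewrite -cz zw c10 scale0r galg0E eq_sym oner_eq0.
  have zXw n : trG w ^+ n * w = c1 ^+ n *: w.
    elim: n => [|n IHn]; first by rewrite !expr0 mul1r scale1r.
    by rewrite exprSr -mulrA zw -scalerAr IHn scalerA -exprS.
  have /eqP := zXw m.+1; rewrite -e0z e00 !mul0r eq_sym scaler_eq0.
  by rewrite expf_eq0 /= (negPf c1n0).
have [e00|e0e] := prim_e e0 (conj ce0 ee0) (sJ _ Je0).
  by rewrite e00 eqxx in e0n0.
apply/seteqP; split=> // u; rewrite /corner /= => <-; rewrite -e0e.
by have [] := iJ u e0 Je0.
Qed.
End SimpleBlocks.

(** * Invariant matrices and the action on involutions *)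

Section Equivariant.
Variables (O : comNzRingType) (gT : finGroupType) (T : finType).
Variable to : {action gT &-> T}.
Implicit Types X Y f : 'M[O]_#|T|.

Definition equivariant X := forall g s t, ent X (to s g) (to t g) = ent X s t.

(** The relative trace from the trivial subgroup, for conjugation by the
    permutation matrices. *)
Definition mxtr f : 'M[O]_#|T| :=
  fun_mx (fun s t => \sum_g ent f (to s g) (to t g)).

Definition prim_idem X :=
  [/\ equivariant X, X * X = X, X <> 0 &
      forall Y, equivariant Y -> Y * Y = Y -> X * Y = Y -> Y * X = Y ->
        Y = 0 \/ Y = X].

Lemma equivariantB X Y : equivariant X -> equivariant Y -> equivariant (X - Y).
Proof. by move=> eX eY g s t; rewrite !entD !entN eX eY. Qed.

Lemma equivariantM X Y : equivariant X -> equivariant Y -> equivariant (X * Y).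
Proof.
move=> eX eY g s t; rewrite !entM (reindex_inj (act_inj to g)) /=.
by apply: eq_bigr => u _; rewrite eX eY.
Qed.

Lemma mxtr_equivariant f : equivariant (mxtr f).
Proof.
move=> g s t; rewrite !ent_fun_mx [RHS](reindex_inj (mulgI g)) /=.
by apply: eq_bigr => h _; rewrite !actM.
Qed.

Lemma mxtrMl X f : equivariant X -> X * mxtr f = mxtr (X * f).
Proof.
move=> eX; apply: entP => s t; rewrite entM ent_fun_mx.
under eq_bigr do rewrite ent_fun_mx mulr_sumr.
rewrite exchange_big /=; apply: eq_bigr => g _; rewrite entM.
rewrite [RHS](reindex_inj (act_inj to g)) /=.
by apply: eq_bigr => u _; rewrite eX.
Qed.

Lemma mxtrMr X f : equivariant X -> mxtr f * X = mxtr (f * X).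
Proof.
move=> eX; apply: entP => s t; rewrite entM ent_fun_mx.
under eq_bigr do rewrite ent_fun_mx mulr_suml.
rewrite exchange_big /=; apply: eq_bigr => g _; rewrite entM.
rewrite [RHS](reindex_inj (act_inj to g)) /=.
by apply: eq_bigr => u _; rewrite eX.
Qed.

Definition act_mx g : 'M[O]_#|T| := fun_mx (fun s t => (to s g == t)%:R).

Lemma act_mxMl g X s t : ent (act_mx g * X) s t = ent X (to s g) t.
Proof.
rewrite entM (bigD1 (to s g)) //= ent_fun_mx eqxx mul1r big1 ?addr0 // => u.
by rewrite ent_fun_mx eq_sym => /negPf ->; rewrite mul0r.
Qed.

Lemma act_mxMr g X s t : ent (X * act_mx g) s (to t g) = ent X s t.
Proof.
rewrite entM (bigD1 t) //= ent_fun_mx eqxx mulr1 big1 ?addr0 // => u nut.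
by rewrite ent_fun_mx (inj_eq (act_inj to g)) (negPf nut) mulr0.
Qed.

(** The form of invariance that passes to limits, inverses and lifts. *)
Lemma equivariantP X : equivariant X <-> forall g, act_mx g * X = X * act_mx g.
Proof.
split=> [eX g|cX g s t]; last by rewrite -act_mxMl cX act_mxMr.
apply: entP => s t; rewrite -(actKV to g t).
by rewrite act_mxMr act_mxMl eX.
Qed.
End Equivariant.

Section Rho.
Variables (gT : finGroupType).
Local Notation Om := (Omega gT).

Lemma OmegaV (s : Om) : (val s)^-1%g = val s.
Proof. by apply/eqP; have /= := valP s; rewrite eq_invg_mul expgS expg1. Qed.

Lemma OmegaMM (s : Om) g : (val s * (val s * g) = g)%g.
Proof. by rewrite -{1}(OmegaV s) mulKg. Qed.

Lemma OmegaM_conj (s t : Om) :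
  ((val s * val t) ^ val s = (val s * val t)^-1)%g.
Proof. by rewrite conjgE invMg !OmegaV -mulgA OmegaMM. Qed.

Lemma conj_inv_eq h g (s t : Om) :
  (h^-1 ^ (g * val s) == val s * val t)%g = (h ^ g == val s * val t)%g.
Proof.
rewrite -(inj_eq (conjg_inj (val s))) OmegaM_conj -conjgM -mulgA.
by rewrite -{2}(OmegaV s) mulgV mulg1 conjVg (inj_eq invg_inj).
Qed.

Section Ring.
Variable O : comNzRingType.
Local Notation A := (galg O gT).
Implicit Types (x y z e : A).

(** The matrix of [z] on the space of elements fixed by the involution
    [galg_inv], modulo the elements [x + galg_inv x], in the basis [Omega]. *)
Definition rho z : 'M[O]_#|{: Om}| := fun_mx (fun s t => z (val s * val t)%g).

Lemma central_mulgC z g h : central z -> z (g * h)%g = z (h * g)%g.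
Proof. by move=> /centralP cz; rewrite -(cz (g * h)%g g) conjgE mulgA mulKg. Qed.

Lemma rho_equivariant z : central z -> equivariant (Omega_action gT) (rho z).
Proof.
by move=> /centralP cz g s t; rewrite !ent_fun_mx /= -conjMg cz.
Qed.

Lemma rhoZ c z : rho (c *: z) = c *: rho z.
Proof. by apply: entP => s t; rewrite entZ !ent_fun_mx galgZE. Qed.

Lemma rhoB x y : rho (x - y) = rho x - rho y.
Proof.
by apply: entP => s t; rewrite entD entN !ent_fun_mx galgDE galgNE.
Qed.

Lemma rho0 : rho 0 = 0.
Proof. by apply: entP => s t; rewrite ent_fun_mx galg0E ent0. Qed.
End Ring.

Section Char2.
Variable k : comNzRingType.
Hypothesis k2 : 2%N \in [pchar k].
Local Notation A := (galg k gT).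
Implicit Types (x y z e : A).

Lemma rho_inv z : central z -> rho (z + galg_inv z) = 0.
Proof.
move=> cz; apply: entP => s t; rewrite ent0 ent_fun_mx galgDE ffunE.
by rewrite invMg !OmegaV (central_mulgC _ _ cz) addrr_pchar2.
Qed.

(** In the sum defining the product, the terms at [u] and [u^-1] agree. *)
Lemma rhoM x y : central x -> central y -> galg_inv x = x -> galg_inv y = y ->
  rho (x * y) = rho x * rho y.
Proof.
move=> cx cy sx sy; apply: entP => s t; rewrite entM ent_fun_mx galgME.
rewrite (reindex_inj (mulgI (val s))) /=.
rewrite (eq_bigr (fun u => x (val s * u)%g * y (u^-1 * val t)%g)) => [|u _].
  rewrite (sum_Omega k2) => [|u].
    by apply: eq_bigr => u _; rewrite !ent_fun_mx OmegaV.
  rewrite -{1}sx -{1}sy !ffunE !invMg !invgK !OmegaV.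
  by rewrite (central_mulgC _ _ cx) (central_mulgC (val t) _ cy).
by rewrite invMg OmegaV -mulgA OmegaMM.
Qed.

(** Conjugation by [a * g * s] and by [g] send [a * b] to [s * t] at the same
    time when these are involutions; the fixed points of [g |-> a * g * s] are
    the [g] that conjugate [a] to [s]. *)
Lemma sum_conj_pair (a b s t : Om) :
  \sum_g ((val a * val b) ^ g == val s * val t)%g%:R =
  \sum_g ((conj_Omega a g == s) && (conj_Omega b g == t))%:R :> k.
Proof.
pose i g := (val a * g * val s)%g.
have iK : involutive i.
  by move=> g; rewrite /i -!mulgA OmegaMM -{1}(OmegaV s) mulVg mulg1.
rewrite (sum_involution_pchar2 k2 iK) => [|g]; last first.
  by rewrite /i -mulgA conjgM OmegaM_conj conj_inv_eq.
rewrite [RHS](bigID (fun g => i g == g)) /= [X in _ + X]big1 ?addr0 => [|g].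
  apply: eq_bigr => g /eqP ig; have ag : (val a ^ g = val s)%g.
    by rewrite conjgE -{2}ig /i -!mulgA OmegaMM mulKg.
  by rewrite conjMg ag (inj_eq (mulgI _)) -!(inj_eq val_inj) /= ag eqxx.
move=> nig; case: eqP => //= ag; case/eqP: nig.
by rewrite /i -ag /= conjgE mulgA mulgK OmegaMM.
Qed.

(** The trace of the matrix unit at [s], [t] is [rho] of the trace of [s * t],
    by [sum_conj_pair]. *)
Lemma mxtr_rho (f : 'M[k]_#|{: Om}|) : exists x,
  mxtr (Omega_action gT) f = rho (trG x) /\ galg_inv (trG x) = trG x.
Proof.
pose x : A := \sum_(p : Om * Om) ent f p.1 p.2 *: delta k (val p.1 * val p.2)%g.
have trxE h : trG x h = \sum_(p : Om * Om)
    ent f p.1 p.2 * \sum_g (h ^ g == val p.1 * val p.2)%g%:R.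
  rewrite ffunE; under eq_bigr do rewrite galg_sumE.
  rewrite exchange_big; apply: eq_bigr => p _; rewrite mulr_sumr.
  by apply: eq_bigr => g _; rewrite galgZE ffunE.
exists x; split.
  apply: entP => a b; rewrite !ent_fun_mx trxE.
  under [RHS]eq_bigr do rewrite sum_conj_pair mulr_sumr.
  rewrite exchange_big /=; apply: eq_bigr => g _.
  rewrite (bigD1 (conj_Omega a g, conj_Omega b g)) //= !eqxx mulr1.
  rewrite big1 ?addr0 // => -[s t] /=; rewrite xpair_eqE ![_ == conj_Omega _ _]eq_sym.
  by move=> /negPf ->; rewrite mulr0.
apply/ffunP=> h; rewrite ffunE !trxE; apply: eq_bigr => -[s t] _ /=.
congr (_ * _); rewrite (reindex_inj (mulIg (val s))) /=.
by apply: eq_bigr => g _; rewrite conj_inv_eq.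
Qed.

(** Since [e] is idempotent, [rho e] is the product of [rho (trG x)] and the
    invariant matrix [rho e]; the sum over the group then moves outside. *)
Lemma rho_mxtr e x : central_idem e -> galg_inv e = e -> e = trG x ->
  exists f, rho e = mxtr (Omega_action gT) f.
Proof.
move=> [ce ee] se etr; pose f := fun_mx (fun a b : Om =>
  \sum_(u : Om) x (val a * val u)%g * e (val u * val b)%g).
exists f; rewrite -{1}ee rhoM //; apply: entP => a b; rewrite entM ent_fun_mx.
under eq_bigr do rewrite !ent_fun_mx {1}etr ffunE mulr_suml.
rewrite exchange_big /=; apply: eq_bigr => g _; rewrite ent_fun_mx.
rewrite [RHS](reindex_inj (act_inj (Omega_action gT) g)) /=.
apply: eq_bigr => u _; rewrite -!conjMg.
by rewrite (proj1 (centralP e) ce).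
Qed.
End Char2.
End Rho.

(** * Projective summands over the residue field *)

Section FieldCase.
Variables (k : closedFieldType) (gT : finGroupType).
Hypothesis k2 : 2%N \in [pchar k].
Local Notation A := (galg k gT).
Local Notation Om := (Omega gT).
Local Notation to := (Omega_action gT).
Implicit Types (a b c d e w x y z : A) (X Y : 'M[k]_#|{: Om}|).

Lemma rank_one_inv a : rank_one a -> rank_one (galg_inv a).
Proof.
move=> a1 b; have [c abac] := a1 (galg_inv b); exists c.
by rewrite -galg_invZ -abac !galg_invM galg_invK mulrA.
Qed.

Lemma rank_one_mul a b d : rank_one d -> rank_one (a * b * d).
Proof.
move=> d1 x; have [c dxd] := d1 (x * a * b); exists c.
by rewrite scalerAr -dxd !mulrA.
Qed.

(** The form is nonzero on rank one idempotents, because [y * a * y] is a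
    multiple of [y] and has the same value as [y * a]. *)
Lemma rank_one_form y : y * y = y -> y != 0 -> rank_one y -> y 1%g != 0.
Proof.
move=> yy yn0 y1; apply: contraNneq yn0 => yg.
apply/eqP/galg_form_nondeg => a; have [c yay] := y1 a.
by rewrite -yy -mulrA galg_formC yay galgZE yg mulr0.
Qed.

(** If [x] is a rank one element, then so is [w = galg_inv x * u * x] for a
    suitable [u]; both [w] and [galg_inv w] lie on the same line, on which the
    involution can only act trivially in characteristic 2. Completing [w] to a
    fixed [v] such that [w * v] is a rank one idempotent shows that the
    fixed elements [w] and [v] have a nonzero product under the form. *)
Lemma simple_real_pair e : central_idem e -> galg_inv e = e ->
    simple_alg (corner e) ->
  exists w v, [/\ w * e = w, galg_inv w = w, galg_inv v = v & (w * v) 1%g != 0].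
Proof.
move=> cie se simple_e; have [ce ee] := cie.
have [x [ex xx xn0 x1]] := simple_rank_one cie simple_e.
set xs := galg_inv x; have exs : e * xs = xs by rewrite ce -{1}se -galg_invM ex.
have xsn0 : xs != 0.
  apply: contraNneq xn0 => xs0; rewrite -[x]galg_invK -/xs xs0.
  by apply/eqP/ffunP=> g; rewrite ffunE !galg0E.
have xs1 : rank_one xs by exact: rank_one_inv.
have [u wn0] := simple_prime cie simple_e exs ex xsn0 xn0.
set w := xs * u * x in wn0; have w1 : rank_one w by exact: rank_one_mul.
have ew : e * w = w by rewrite !mulrA exs.
have [b wbw0] := simple_prime cie simple_e ew ew wn0 wn0.
have [c wbw] := w1 b; have c0 : c != 0.
  by apply: contraNneq wbw0 => c0; rewrite wbw c0 scale0r.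
set v0 := c^-1 *: b; have wvw : w * v0 * w = w.
  by rewrite -scalerAr -scalerAl wbw scalerA mulVf // scale1r.
have ws : galg_inv w = xs * galg_inv u * x.
  by rewrite !galg_invM galg_invK mulrA.
have [c1 e1] := x1 (v0 * xs * galg_inv u).
have [c2 e2] := xs1 (u * x * v0).
have c21 : c2 = 1.
  have : w = c2 *: w.
    rewrite -{1}wvw; transitivity (xs * (u * x * v0) * xs * (u * x)).
      by rewrite /w !mulrA.
    by rewrite e2 -scalerAl mulrA.
  rewrite -{1}[w]scale1r => /eqP; rewrite -subr_eq0 -scalerBl scaler_eq0.
  by rewrite (negPf wn0) orbF subr_eq0 eq_sym => /eqP.
have ws1 : galg_inv w = c1 *: w.
  transitivity (w * v0 * galg_inv w); rewrite ws.
    transitivity (xs * (u * x * v0) * xs * (galg_inv u * x)).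
      by rewrite e2 c21 scale1r mulrA.
    by rewrite /w !mulrA.
  transitivity (xs * u * (x * (v0 * xs * galg_inv u) * x)).
    by rewrite /w !mulrA.
  by rewrite e1 -scalerAr.
have c11 : c1 = 1.
  have : (1 - c1 ^+ 2) *: w = 0.
    by rewrite scalerBl scale1r -scalerA -ws1 -galg_invZ -ws1 galg_invK subrr.
  move/eqP; rewrite scaler_eq0 (negPf wn0) orbF subr_eq0 eq_sym sqrf_eq1.
  by rewrite (oppr_pchar2 k2) orbb => /eqP.
have {c11}ws1 : galg_inv w = w by rewrite ws1 c11 scale1r.
clearbody w; have wvsw : w * galg_inv v0 * w = w.
  by have := congr1 (@galg_inv k gT) wvw; rewrite !galg_invM ws1 mulrA.
exists w, (v0 * w * galg_inv v0); split=> //.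
- by rewrite -ce.
- by rewrite !galg_invM galg_invK ws1 mulrA.
rewrite !mulrA wvw; apply: rank_one_form.
- by rewrite mulrA wvsw.
- by apply: contraNneq wn0 => y0; rewrite -wvsw y0 mul0r.
move=> y; have [c3 e3] := w1 (galg_inv v0 * y); exists c3.
by rewrite scalerAl -e3 !mulrA.
Qed.

(** If [rho e = 0], then the fixed elements of [corner e] vanish on [Omega],
    hence the form vanishes on pairs of fixed elements. *)
Lemma rho_neq0 e : central_idem e -> galg_inv e = e ->
  simple_alg (corner e) -> rho e <> 0.
Proof.
move=> cie se simple_e rho_e0; have [ce ee] := cie.
have [w [v [we sw sv /eqP]]] := simple_real_pair cie se simple_e; apply.
have w0 (s : Om) : w (val s) = 0.
  rewrite -we galgME (sum_Omega k2) => [|u].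
    apply: big1 => t _; have := congr1 (fun X => ent X t s) rho_e0.
    by rewrite ent_fun_mx ent0 OmegaV => ->; rewrite mulr0.
  rewrite -{1}sw -{1}se !ffunE !invMg !invgK OmegaV.
  by rewrite (central_mulgC _ _ ce).
rewrite galgME (sum_Omega k2) => [|u].
  by apply: big1 => t _; rewrite w0 mul0r.
by rewrite -{1}sw -{1}sv !ffunE !mulg1 !invgK.
Qed.

(** The element [e * trG x] is in the center of the simple block of [e]. *)
Lemma trG_rho_scalar e x : central_idem e -> galg_inv e = e ->
    simple_alg (corner e) -> galg_inv (trG x) = trG x ->
  exists c : k, rho e * rho (trG x) = c *: rho e.
Proof.
move=> cie se simple_e sx; have [ce ee] := cie.
have [||c ec] := @simple_center k gT e cie simple_e (e * trG x).
- by apply: centralM => //; exact: trG_central.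
- by rewrite mulrA ee.
by exists c; rewrite -(rhoM k2) // ?ec ?rhoZ //; exact: trG_central.
Qed.

(** The summand attached to a simple real block is a trace, and traces are
    commuting elements [rho z]; so it is central in the endomorphism ring, with
    a corner of dimension one. *)
Lemma rho_simple_prim e X : central_idem e -> galg_inv e = e ->
    simple_alg (corner e) -> prim_idem to X -> rho e * X <> 0 -> X = rho e.
Proof.
move=> cie se simple_e [eqX XX _ primX] eX0; have [ce ee] := cie.
have rho_n0 := rho_neq0 cie se simple_e.
have rho_ee : rho e * rho e = rho e by rewrite -(rhoM k2) // ee.
have eqe : equivariant to (rho e) by exact: rho_equivariant.
have [x0 ex0] := simple_trG cie simple_e.
have [f def_e] := rho_mxtr k2 cie se ex0.
have scal_eq (c1 c2 : k) : c1 *: rho e = c2 *: rho e -> c1 = c2.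
  move=> /eqP; rewrite -subr_eq0 -scalerBl scaler_eq0 subr_eq0.
  by case/orP=> /eqP.
have [c1 e1] : exists c : k, rho e * X = c *: rho e.
  have [x [defeX sx]] := mxtr_rho k2 (f * X).
  have [c ec] := trG_rho_scalar cie se simple_e sx; exists c.
  by rewrite -{1}rho_ee -mulrA {2}def_e (mxtrMr _ eqX) defeX.
have [c3 e3] : exists c : k, X * rho e = c *: rho e.
  have [x [defXe sx]] := mxtr_rho k2 (X * f).
  have [c ec] := trG_rho_scalar cie se simple_e sx; exists c.
  rewrite -{1}rho_ee mulrA def_e (mxtrMl _ eqX) -def_e defXe -ec.
  by rewrite -!(rhoM k2) ?ce //; exact: trG_central.
have c11 : c1 = 1.
  have : c1 * c1 = c1 * 1.
    apply: scal_eq; rewrite mulr1 -scalerA -e1 -[in RHS]XX mulrA e1.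
    by rewrite mx_scalerAl e1.
  by apply: mulfI; apply/eqP=> c10; apply: eX0; rewrite e1 c10 scale0r.
have eX : rho e * X = rho e by rewrite e1 c11 scale1r.
have Xe1 : X * rho e = rho e.
  rewrite e3 (_ : c3 = 1) ?scale1r //; apply: scal_eq.
  by rewrite scale1r -[RHS]rho_ee -{2}eX -mulrA e3 mx_scalerAr rho_ee.
by have [//|<-] := primX (rho e) eqe rho_ee Xe1 eX.
Qed.

(** A projective primitive idempotent [X] is [rho z] for a real central trace
    [z]. Among the real central idempotents of [z * A] that act as the identity
    on [X], take one of least rank. It is primitive among the real ones since
    [X] is, and a splitting [c], [galg_inv c] is excluded because such a pair
    acts as zero. *)
Lemma prim_mxtr_rho X f : prim_idem to X -> X = mxtr to f ->
  exists e, [/\ block_idem e, galg_inv e = e, simple_alg (corner e) & X = rho e].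
Proof.
move=> [eqX XX Xn0 primX]; have [x [-> sz]] := mxtr_rho k2 f.
set z := trG x in sz * => defX; have cz : central z := trG_central x.
have rho_z n : rho (z ^+ n.+1) = X.
  elim: n => [|n IHn]; first by rewrite expr1 defX.
  rewrite exprS (rhoM k2) // ?IHn -?defX //; first exact: centralX.
  by rewrite galg_invX sz.
pose P e :=
  [/\ central_idem e, galg_inv e = e, exists d, e = z * d & rho e * X = X].
have [e0 Pe0] : exists e, P e.
  have [e [[ce ee] ez [m em] se]] := central_fitting cz; exists e.
  split=> //; first exact: se; rewrite -(rho_z m) -(rhoM k2) ?em //.
  - exact: centralX.
  - exact: se.
  - by rewrite galg_invX sz.
pose Q r := `[< exists e, P e /\ \rank (reg e) = r >].
have exQ : exists r, Q r by exists (\rank (reg e0)); apply/asboolP; exists e0.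
case: (ex_minnP exQ) => r /asboolP[e [Pe re]] minr.
have [[ce ee] se [d ezd] eX] := Pe.
(* Equality of ranks forces [e] to be a multiple of [c]. *)
have min_e c : P c -> e * c = c -> c = e.
  move=> Pc ec; have [[cc ccc] _ _ _] := Pc.
  have sce : (reg c <= reg e)%MS by rewrite -ec ce regM submxMl.
  have /submxP[D defe] : (reg e <= reg c)%MS.
    move/mxrank_leqif_sup: sce => /geq_leqif <-; rewrite re; apply: minr.
    by apply/asboolP; exists c.
  have [d' ed] := reg_factor defe.
  by rewrite -ec {1}ed -mulrA ccc -ed.
(* As [X] is primitive, [c] or [e - c] acts as the identity on [X]. *)
have prim_real c :
  central_idem c -> galg_inv c = c -> e * c = c -> c = 0 \/ c = e.
  move=> cic sc ec; have [cc ccc] := cic.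
  have rhocX : rho c * X = X * rho c by rewrite defX -!(rhoM k2) // cc.
  have [||||cX0|cX] := primX (rho c * X).
  - by apply: equivariantM => //; exact: rho_equivariant.
  - by rewrite {2}rhocX mulrA -[rho c * X * X]mulrA XX -mulrA -rhocX mulrA
               -(rhoM k2) // ccc.
  - by rewrite mulrA -rhocX -mulrA XX.
  - by rewrite -mulrA XX.
  - left; apply/eqP; rewrite -oppr_eq0 -(inj_eq (addrI e)) addr0; apply/eqP.
    apply: min_e; last by rewrite mulrBr ee ec.
    split; first exact: central_idemB.
    + by rewrite galg_invB se sc.
    + by exists (d - d * c); rewrite mulrBr mulrA -ezd ec.
    by rewrite rhoB mulrBl eX cX0 subr0.
  right; apply: min_e => //; split=> //.
  by exists (d * c); rewrite mulrA -ezd ec.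
have en0 : e != 0.
  by apply/eqP=> e0'; apply: Xn0; rewrite -eX e0' rho0 mul0r.
have prim_e : block_idem e.
  split=> // c cic ec; have [cc ccc] := cic.
  have [csc scc] := central_idem_inv cic.
  have esc : e * galg_inv c = galg_inv c by rewrite ce -{1}se -galg_invM ec.
  have [||| p0|pe] := prim_real (c * galg_inv c).
  - by apply: central_idemM => //; exact: central_idem_inv.
  - by rewrite galg_invM galg_invK.
  - by rewrite mulrA ec.
  - left; have p0' : galg_inv c * c = 0 by rewrite csc.
    have [||| q0|qe] := prim_real (c + galg_inv c).
    + split; first exact: centralD.
      by rewrite mulrDl !mulrDr ccc scc p0 p0' addr0 add0r.
    + by rewrite galg_invD galg_invK addrC.
    + by rewrite mulrDr ec esc.
    + by move: q0 => /(congr1 (fun y => c * y)); rewrite mulrDr ccc p0 addr0 mulr0.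
    by case: Xn0; rewrite -eX -qe (rho_inv k2) // mul0r.
  by right; rewrite -ec -pe -mulrA csc -csc mulrA -csc -mulrA ccc.
have simple_e : simple_alg (corner e) by exact: trG_simple prim_e ezd.
exists e; split=> //; have [c ec] := trG_rho_scalar (conj ce ee) se simple_e sz.
have rho_n0 := rho_neq0 (conj ce ee) se simple_e.
have Xc : X = c *: rho e by rewrite -eX defX.
have rho_ee : rho e * rho e = rho e by rewrite -(rhoM k2) // ee.
have cn0 : c != 0 by apply/eqP=> c0; apply: Xn0; rewrite Xc c0 scale0r.
have : c *: X = 1 *: X.
  by rewrite scale1r -[RHS]XX {3}Xc mx_scalerAr; congr (_ *: _);
    rewrite Xc mx_scalerAl rho_ee.
move/eqP; rewrite -subr_eq0 -scalerBl scaler_eq0 subr_eq0.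
by case/orP=> [/eqP c1|/eqP//]; rewrite Xc c1 scale1r.
Qed.
End FieldCase.

(** * Reduction modulo the maximal ideal *)

Section Reduction.
Variables (O : comUnitRingType) (k : closedFieldType) (red : {rmorphism O -> k}).
Hypothesis red_surj : forall y, exists x, red x = y.
Hypothesis red_unit : forall x, red x \is a GRing.unit -> x \is a GRing.unit.
Hypothesis idem_lift : forall n (B : 'M[O]_n),
  map_mx red (B *m B) = map_mx red B ->
  exists E : 'M[O]_n, [/\ E *m E = E, map_mx red E = map_mx red B &
    forall P, P *m B = B *m P -> P *m E = E *m P].

Definition red_section y : O := projT1 (cid (red_surj y)).

Lemma red_sectionK y : red (red_section y) = y.
Proof. by rewrite /red_section; case: cid. Qed.

Section Endomorphisms.
Variables (gT : finGroupType) (T : finType) (to : {action gT &-> T}).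
Implicit Types X f : 'M[O]_#|T|.

Lemma ent_red X s t : ent (map_mx red X) s t = red (ent X s t).
Proof. by rewrite /ent mxE. Qed.

Lemma red_mxM X (Y : 'M[O]_#|T|) : map_mx red (X * Y) = map_mx red X * map_mx red Y.
Proof. exact: map_mxM. Qed.

Lemma red_mxB X (Y : 'M[O]_#|T|) : map_mx red (X - Y) = map_mx red X - map_mx red Y.
Proof. exact: map_mxB. Qed.

Lemma equivariant_red X : equivariant to X -> equivariant to (map_mx red X).
Proof. by move=> eX g s t; rewrite !ent_red eX. Qed.

Lemma mxtr_red f : map_mx red (mxtr to f) = mxtr to (map_mx red f).
Proof.
apply: entP => s t; rewrite ent_red !ent_fun_mx rmorph_sum.
by apply: eq_bigr => g _; rewrite ent_red.
Qed.

Definition mx_section (Y : 'M[k]_#|T|) : 'M[O]_#|T| := map_mx red_section Y.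

Lemma mx_sectionK (Y : 'M[k]_#|T|) : map_mx red (mx_section Y) = Y.
Proof. by apply/matrixP=> i j; rewrite !mxE red_sectionK. Qed.

(** Any section of the reduction map preserves equalities between entries. *)
Lemma equivariant_section (Y : 'M[k]_#|T|) :
  equivariant to Y -> equivariant to (mx_section Y).
Proof.
move=> eY g s t; have := eY g s t; rewrite /ent !mxE.
by rewrite /ent => ->.
Qed.

Lemma equivariant_commute X E : equivariant to X ->
  (forall P, P *m X = X *m P -> P *m E = E *m P) -> equivariant to E.
Proof.
move=> /equivariantP cX cE; apply/equivariantP => g; exact: cE (cX g).
Qed.

(** A splitting of the reduction lifts, inside the corner ring of [X] since the
    lift commutes with [X]. *)
Lemma prim_idem_red X : prim_idem to X -> prim_idem to (map_mx red X).
Proof.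
move=> [eX XX Xn0 primX]; split; first exact: equivariant_red.
- by rewrite -red_mxM XX.
- by move=> X0; apply: Xn0; apply: idem_mx_red0 red_unit _ _ _ X0.
move=> Y eY YY XY YX.
pose B := X * mx_section Y * X.
have eB : equivariant to B.
  by do 2!apply: equivariantM => //; exact: equivariant_section.
have redB : map_mx red B = Y by rewrite !red_mxM mx_sectionK XY YX.
have [|E [EE redE cE]] := @idem_lift _ B; first by rewrite [LHS]red_mxM redB YY.
have eE := equivariant_commute eB cE.
have XE : X * E = E * X.
  by apply: cE; rewrite -[LHS]/(X * B) -[RHS]/(B * X) /B -!mulrA XX !mulrA XX.
have [||||XE0|XEX] := primX (X * E).
- exact: equivariantM.
- by rewrite {2}XE mulrA -[X * E * E]mulrA [E * E]EE -mulrA -XE mulrA XX.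
- by rewrite mulrA XX.
- by rewrite -mulrA -XE mulrA XX.
- left; have := congr1 (map_mx red) XE0.
  by rewrite red_mxM redE redB XY map_mx0.
by right; have := congr1 (map_mx red) XEX; rewrite red_mxM redE redB XY.
Qed.

(** If [X] is a trace modulo the radical, say of [f], then [X * mxtr f * X]
    is a unit of the corner ring of [X], and traces form an ideal. *)
Lemma mxtr_red_lift X (f : 'M[k]_#|T|) :
    equivariant to X -> X * X = X -> map_mx red X = mxtr to f ->
  exists f', X = mxtr to f'.
Proof.
move=> eX XX redX; pose tau := mxtr to (mx_section f).
have red_tau : map_mx red tau = map_mx red X by rewrite mxtr_red mx_sectionK redX.
have eXtX : equivariant to (X * tau * X).
  by do 2!apply: equivariantM => //; exact: mxtr_equivariant.
pose D := X - X * tau * X.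
have redD : map_mx red D = 0.
  by rewrite red_mxB !red_mxM red_tau -!red_mxM !XX subrr.
have u1D : 1%:M - D \in unitmx.
  rewrite unitmxE; apply: red_unit; rewrite -det_map_mx map_mxB redD subr0.
  by rewrite map_mx1 det1 unitr1.
have eD : equivariant to D by exact: equivariantB.
set U := invmx (1%:M - D).
have eU : equivariant to U.
  apply/equivariantP=> g; have /equivariantP/(_ g) cD := eD.
  have cV : act_mx O to g * (1%:M - D) = (1%:M - D) * act_mx O to g.
    by rewrite mulrBl mulrBr cD mulr1 mul1r.
  have VU : (1%:M - D) * U = 1 by exact: mulmxV.
  have UV : U * (1%:M - D) = 1 by exact: mulVmx.
  by rewrite -[LHS]mul1r -UV mulrA -[U * _ * _]mulrA -cV -!mulrA VU mulr1.
have VX : (1%:M - D) * X = X * tau * X.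
  have DX : D * X = X - X * tau * X by rewrite /D mulrBl XX -(mulrA _ X X) XX.
  by rewrite mulrBl mul1r DX opprB addrC subrK.
have UVX : X = U * (X * tau * X) by rewrite -VX [RHS]mulKmx.
exists (U * (X * mx_section f * X)); rewrite {1}UVX.
by rewrite mxtrMl // mxtrMr // mxtrMl.
Qed.
End Endomorphisms.

Section BlockReduction.
Variable gT : finGroupType.
Implicit Types (e c x y : galg O gT).
Local Notation rd := (@galg_map O k gT red).

Lemma galg_mapE x g : rd x g = red (x g). Proof. by rewrite ffunE. Qed.

Lemma galg_mapM x y : rd (x * y) = rd x * rd y.
Proof.
apply/ffunP=> g; rewrite galg_mapE !galgME rmorph_sum.
by apply: eq_bigr => h _; rewrite rmorphM !galg_mapE.
Qed.

Lemma galg_mapB x y : rd (x - y) = rd x - rd y.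
Proof.
apply/ffunP=> g; rewrite galgDE galgNE !galg_mapE galgDE galgNE.
exact: rmorphB.
Qed.

Lemma galg_map0 : rd 0 = 0.
Proof. by rewrite -(subrr 0) galg_mapB subrr. Qed.

Lemma galg_map_inv x : rd (galg_inv x) = galg_inv (rd x).
Proof. by apply/ffunP=> g; rewrite !ffunE. Qed.

Lemma central_red x : central x -> central (rd x).
Proof.
by move=> /centralP cx; apply/centralP=> g h; rewrite !galg_mapE cx.
Qed.

Lemma central_idem_red e : central_idem e -> central_idem (rd e).
Proof. by move=> [ce ee]; split; [exact: central_red|rewrite -galg_mapM ee]. Qed.

Lemma reg_red x : map_mx red (reg x) = reg (rd x).
Proof. by apply: entP => s t; rewrite ent_red !ent_fun_mx galg_mapE. Qed.

Lemma central_idem_red0 e : central_idem e -> rd e = 0 -> e = 0.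
Proof.
move=> [_ ee] re0; apply: reg_inj; rewrite reg0.
apply: idem_mx_red0 red_unit _ _ _ _; first by rewrite -[LHS]regM ee.
by rewrite reg_red re0 reg0.
Qed.

(** The difference [e - e * c] is an idempotent that vanishes on reduction. *)
Lemma central_idem_red_inj e c :
  central_idem e -> central_idem c -> rd e = rd c -> e = c.
Proof.
move=> cie cic re; have ciec := central_idemM cie cic.
have [[ce ee] [cc ccc]] := (cie, cic).
have eqe : e - e * c = 0.
  apply: central_idem_red0; first by apply: central_idemB; rewrite // mulrA ee.
  by rewrite galg_mapB galg_mapM -re -galg_mapM ee subrr.
have eqc : c - e * c = 0.
  apply: central_idem_red0.
    by apply: central_idemB; rewrite // cc -mulrA ccc.
  by rewrite galg_mapB galg_mapM re -galg_mapM ccc subrr.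
by move/eqP: eqe; move/eqP: eqc; rewrite !subr_eq0 => /eqP{2}-> /eqP.
Qed.

(** The inverse makes left translation a right action. *)
Definition left_mul (s g : gT) : gT := (g^-1 * s)%g.
Fact left_mul1 : left_mul^~ 1%g =1 id.
Proof. by move=> s; rewrite /left_mul invg1 mul1g. Qed.
Fact left_mulM s : act_morph left_mul s.
Proof. by move=> g h; rewrite /left_mul invMg mulgA. Qed.
Definition left_mul_action : {action gT &-> gT} :=
  TotalAction left_mul1 left_mulM.

(** A lift of the regular matrix that commutes with left translations is again
    a regular matrix. *)
Lemma central_idem_lift (u : galg k gT) :
  central_idem u -> exists e, central_idem e /\ rd e = u.
Proof.
move=> [/centralP cu uu]; pose c : galg O gT := [ffun g => red_section (u g)].
have cc : central c by apply/centralP=> g h; rewrite !ffunE cu.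
have rc : rd c = u by apply/ffunP=> g; rewrite !ffunE red_sectionK.
have [|E [EE redE cE]] := @idem_lift _ (reg c).
  by rewrite -[reg c *m reg c]regM !reg_red galg_mapM rc uu.
have eE : equivariant left_mul_action E.
  apply: (equivariant_commute _ cE) => g s t; rewrite !ent_fun_mx /= /left_mul.
  by rewrite invMg invgK -mulgA mulKVg.
pose e : galg O gT := [ffun t => ent E 1%g t].
have defE : E = reg e.
  apply: entP => s t; rewrite ent_fun_mx ffunE -(eE s) /= /left_mul.
  by rewrite mulVg.
exists e; split; first split.
- move=> a; apply: reg_inj; rewrite !regM -defE; apply/esym/cE.
  by rewrite -[LHS]regM -[RHS]regM cc.
- by apply: reg_inj; rewrite regM -defE.
apply: reg_inj; rewrite -rc -!reg_red -defE; exact: redE.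
Qed.

Lemma block_idem_red e : block_idem e -> block_idem (rd e).
Proof.
move=> [cie en0 prim_e]; split; first exact: central_idem_red.
  by apply: contraNneq en0 => /(central_idem_red0 cie) ->.
move=> u ciu eu; have [c [cic rcu]] := central_idem_lift ciu.
have eec : e * (e * c) = e * c by rewrite mulrA cie.2.
have rec : rd (e * c) = u by rewrite galg_mapM rcu.
case: (prim_e _ (central_idemM cie cic) eec) => ec; [left|right].
  by rewrite -rec ec galg_map0.
by rewrite -rec ec.
Qed.

Lemma block_idem_lift (u : galg k gT) :
  block_idem u -> exists e, block_idem e /\ rd e = u.
Proof.
move=> [ciu un0 prim_u]; have [e [cie reu]] := central_idem_lift ciu.
exists e; split=> //; split=> //.
  by apply: contraNneq un0 => e0; rewrite -reu e0 galg_map0.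
move=> c cic ec; have uc : u * rd c = rd c by rewrite -reu -galg_mapM ec.
have [c0|cu] := prim_u _ (central_idem_red cic) uc.
  by left; exact: central_idem_red0.
by right; apply: central_idem_red_inj => //; rewrite reu.
Qed.

Lemma corner_red e : central_idem e -> rd @` corner e = corner (rd e).
Proof.
move=> [ce ee]; apply/seteqP; split=> y; rewrite /corner /=.
  by case=> x ex <-; rewrite -galg_mapM ex.
move=> ey; pose x : galg O gT := [ffun g => red_section (y g)].
have rx : rd x = y by apply/ffunP=> g; rewrite !ffunE red_sectionK.
by exists (e * x); rewrite /= ?mulrA ?ee // galg_mapM rx.
Qed.
End BlockReduction.
End Reduction.

(** * Lifting idempotents over a complete discrete valuation ring *)

Section CompleteDVR.
Variables (k : closedFieldType) (k2 : 2%N \in [pchar k]) (R : idomainType).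
Hypotheses (R_dvr : is_dvr R) (R_complete : is_complete R).
Variable red : {rmorphism R -> k}.
Hypothesis red_ker : forall x, red x = 0 <-> x \isn't a GRing.unit.

(** The intersection of the ideals of the [p ^+ n] is principal, say generated by
    [a]; then [a] is a multiple of [a * p], hence zero. *)
Lemma dvr_uniformizer : exists p : R,
  (forall x, x \isn't a GRing.unit <-> exists y, x = y * p) /\
  (forall x, (forall n, exists y, x = y * p ^+ n) -> x = 0).
Proof.
have [pid nonunitD [x0 x0n0 nux0]] := R_dvr.
have submod_nu : submodule ([set x : R | x \isn't a GRing.unit] : set R^o).
  apply/submoduleE; split=> [|a u v nu nv] /=; first by rewrite unitr0.
  apply: nonunitD => //; rewrite inE /=; apply: contra nu.
  by rewrite /= [a *: u]/(a * u) unitrM => /andP[].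
have [p nuE] := pid _ submod_nu.
have nuP x : x \isn't a GRing.unit <-> exists y, x = y * p.
  have -> : (x \isn't a GRing.unit : Prop) = [set y * p | y in setT] x.
    by rewrite -nuE.
  by split=> [[y _ <-]|[y ->]]; exists y.
have p0 : p != 0.
  by apply: contraNneq x0n0 => p0; have [y ->] := (nuP x0).1 nux0; rewrite p0 mulr0.
exists p; split=> // x x_inf.
have submod_inf :
    submodule ([set x : R | forall n, exists y, x = y * p ^+ n] : set R^o).
  apply/submoduleE; split=> [n|a u v iu iv n] /=; first by exists 0; rewrite mul0r.
  have [[y ->] [z ->]] := (iu n, iv n).
  by exists (a * y + z); rewrite mulrDl -mulrA.
have [a infE] := pid _ submod_inf.
have infP y : (forall n, exists z, y = z * p ^+ n) <-> exists z, y = z * a.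
  have -> : (forall n, exists z, y = z * p ^+ n) = [set y * a | y in setT] y.
    by rewrite -infE.
  by split=> [[z _ <-]|[z ->]]; exists z.
have inf_a : forall n, exists z, a = z * p ^+ n.
  by apply/infP; exists 1; rewrite mul1r.
have [b ab] := inf_a 1%N; rewrite expr1 in ab.
have [c bc] : exists c, b = c * a.
  apply/infP=> n; have [z az] := inf_a n.+1; exists z; apply: (mulIf p0).
  by rewrite -ab {1}az exprSr mulrA.
have u1 : 1 - c * p \is a GRing.unit.
  apply: contraT => nu; suff : (1 : R) \isn't a GRing.unit by rewrite unitr1.
  rewrite -(subrK (c * p) 1); apply: nonunitD => //; rewrite inE /=.
  by apply/nuP; exists c.
have /eqP : (1 - c * p) * a = 0.
  by rewrite mulrBl mul1r {1}ab bc mulrAC subrr.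
rewrite mulf_eq0 (negPf (_ : 1 - c * p != 0)) /= => [/eqP a0|]; last first.
  by apply: contraTneq u1 => ->; rewrite unitr0.
by have [z ->] := (infP x).1 x_inf; rewrite a0 mulr0.
Qed.

(** As 2 lies in the maximal ideal, squaring improves an approximate idempotent:
    [b ^+ 4 - b ^+ 2 = (b ^+ 2 - b) * ((b ^+ 2 - b) + 2 * b)]. So the sequence of
    the [b ^+ (2 ^ n)] converges to an idempotent; as a limit of powers, it
    commutes with whatever commutes with [b]. *)
Lemma dvr_idem_lift n (B : 'M[R]_n) :
  map_mx red (B *m B) = map_mx red B ->
  exists E : 'M[R]_n, [/\ E *m E = E, map_mx red E = map_mx red B &
    forall P, P *m B = B *m P -> P *m E = E *m P].
Proof.
move=> redBB; have [p [nuP inf0]] := dvr_uniformizer.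
have redp : red p = 0 by apply/red_ker/nuP; exists 1; rewrite mul1r.
pose D m (X : 'M[R]_n) := exists C, X = p ^+ m *: C.
have entD m (X : 'M[R]_n) : (forall i j, exists y, X i j = y * p ^+ m) -> D m X.
  move=> Xp; exists (\matrix_(i, j) projT1 (cid (Xp i j))).
  by apply/matrixP=> i j; rewrite !mxE; case: cid => y /= ->; rewrite mulrC.
have Dent m (X : 'M[R]_n) i j : D m X -> exists y, X i j = y * p ^+ m.
  by move=> [C ->]; exists (C i j); rewrite mxE mulrC.
have D0 (X : 'M[R]_n) : (forall m, D m X) -> X = 0.
  move=> DX; apply/matrixP=> i j; rewrite mxE; apply: inf0 => m.
  exact: Dent (DX m).
have DD m X Y : D m X -> D m Y -> D m (X + Y).
  by move=> [C ->] [C' ->]; exists (C + C'); rewrite scalerDr.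
have DN m X : D m X -> D m (- X).
  by move=> [C ->]; exists (- C); rewrite scalerN.
have DMl m X Y : D m X -> D m (Y *m X).
  by move=> [C ->]; exists (Y *m C); rewrite scalemxAr.
have DMr m X Y : D m X -> D m (X *m Y).
  by move=> [C ->]; exists (C *m Y); rewrite scalemxAl.
have DS m m' X : (m <= m')%N -> D m' X -> D m X.
  move=> le_m [C ->]; exists (p ^+ (m' - m) *: C).
  by rewrite scalerA -exprD subnKC.
pose b m : 'M[R]_n := iter m (fun X => X *m X) B.
have D2 : D 1%N (2%:R%:M).
  apply: entD => i j; rewrite mxE expr1.
  have [y ->] : exists y, 2%:R = y * p.
    by apply/nuP/red_ker; rewrite rmorph_nat (pcharf0 k2).
  by case: (i == j); [exists y; rewrite mulr1n|exists 0; rewrite mulr0n mul0r].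
have Db m : D m.+1 (b m.+1 - b m).
  elim: m => [|m [C eC]].
    apply: entD => i j; rewrite expr1; apply/nuP/red_ker.
    have := congr1 (fun X : 'M_n => X i j) redBB.
    by rewrite !mxE rmorphB => ->; rewrite subrr.
  have -> : b m.+2 - b m.+1 = (b m.+1 - b m) *m (b m.+1 - b m + 2%:R%:M *m b m).
    have -> : b m.+1 - b m + 2%:R%:M *m b m = b m.+1 + b m.
      by rewrite mul_scalar_mx scaler_nat mulr2n addrA subrK.
    have bC : b m *m b m.+1 = b m.+1 *m b m by rewrite /= mulmxA.
    by rewrite mulmxBl !mulmxDr bC opprD addrA addrK.
  have [C2 e2] : D 1%N (b m.+1 - b m + 2%:R%:M *m b m).
    by apply: DD; [apply: (DS 1%N m.+1) => //; exists C|exact: DMr].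
  exists (C *m C2); rewrite e2 eC -scalemxAl -scalemxAr scalerA expr1.
  by rewrite -exprSr.
have Dbb m m' : (m <= m')%N -> D m (b m' - b m).
  elim: m' => [|m' IH].
    by rewrite leqn0 => /eqP->; exists 0; rewrite subrr scaler0.
  rewrite leq_eqVlt ltnS => /predU1P[->|le_m].
    by exists 0; rewrite subrr scaler0.
  rewrite -(subrK (b m') (b m'.+1)) -addrA; apply: DD; last exact: IH.
  by apply: (DS m m'.+1) => //; exact: leqW.
have lim_ij i j : exists l, forall m, exists N, forall m', (N <= m')%N ->
    exists y, b m' i j - l = y * p ^+ m.
  apply: (R_complete nuP) => m; exists m => m1 m2 le1 le2.
  have : D m (b m1 - b m2).
    by rewrite -(subrKA (b m)) -[b m - _]opprB; apply/DD/DN; exact: Dbb.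
  by move=> /(Dent _ _ i j); rewrite !mxE.
pose E : 'M[R]_n := \matrix_(i, j) projT1 (cid (lim_ij i j)).
have DE m : D m (b m - E).
  apply: entD => i j; rewrite !mxE; case: cid => l /= /(_ m)[N limN].
  have [y ey] := limN (maxn N m) (leq_maxl _ _).
  have [z ez] := Dent _ _ i j (Dbb m (maxn N m) (leq_maxr _ _)).
  by exists (y - z); rewrite mulrBl -ey -ez !mxE opprB [RHS]addrC subrKA.
have cE P : P *m B = B *m P -> P *m E = E *m P.
  move=> PB; have Pb m : P *m b m = b m *m P.
    by elim: m => //= m IH; rewrite mulmxA IH -!mulmxA IH.
  apply/eqP; rewrite -subr_eq0; apply/eqP/D0 => m.
  have -> : P *m E - E *m P = (b m - E) *m P - P *m (b m - E).
    by rewrite mulmxBl mulmxBr Pb opprB [RHS]addrC subrKA.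
  by apply: DD; [exact: DMr|apply/DN/DMl].
exists E; split=> //.
  apply/eqP; rewrite -subr_eq0; apply/eqP/D0 => m.
  have -> : E *m E - E =
      - ((b m - E) *m b m + E *m (b m - E)) + (b m.+1 - E).
    by rewrite mulmxBl mulmxBr subrKA opprB subrKA.
  apply: (DD); last by apply: (DS m m.+1).
  by apply/DN/DD; [exact: DMr|exact: DMl].
have [C e1] := DE 1%N.
have : map_mx red (b 1%N - E) = 0.
  by rewrite e1 map_mxZ expr1 redp scale0r.
by rewrite map_mxB => /eqP; rewrite subr_eq0 -redBB => /eqP <-.
Qed.
End CompleteDVR.

(** * Endomorphisms of permutation modules *)

Section PermutationEndomorphisms.
Variables (O : comNzRingType) (gT : finGroupType) (T : finType).
Variable to : {action gT &-> T}.
Local Notation A := (galg O gT).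
Local Notation V := (permmod O to).
Implicit Types (X Y f : 'M[O]_#|T|) (u v : V) (a c : A^c).

Definition basis s : V := [ffun t => (t == s)%:R].

Definition app X v : V := [ffun t => \sum_s v s * ent X s t].

Lemma permDE u v t : (u + v) t = u t + v t. Proof. exact: ffunE. Qed.
Lemma perm0E t : (0 : V) t = 0. Proof. exact: ffunE. Qed.
Lemma perm_sumE (I : finType) (F : I -> V) t : (\sum_i F i) t = \sum_i F i t.
Proof. exact: sum_ffunE. Qed.
Lemma permZE a v t : (a *: v) t = \sum_g (a : A) g * v (to t g^-1%g).
Proof. exact: ffunE. Qed.

Lemma permZ_const (r : O) v t : (((r *: (1 : A)) : A^c) *: v) t = r * v t.
Proof.
rewrite permZE (bigD1 1%g) //= galgZE galg1E eqxx mulr1 invg1 act1.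
rewrite big1 ?addr0 // => g /negPf ng1.
by rewrite galgZE galg1E ng1 mulr0 mul0r.
Qed.

Lemma permZ_delta g v t : ((delta O g : A^c) *: v) t = v (to t g^-1%g).
Proof.
rewrite permZE (bigD1 g) //= ffunE eqxx mul1r big1 ?addr0 // => h /negPf nhg.
by rewrite ffunE nhg mul0r.
Qed.

Lemma basis_act g s : (delta O g : A^c) *: basis s = basis (to s g).
Proof.
apply/ffunP=> t; rewrite permZ_delta !ffunE; congr (_ %:R).
by rewrite -(inj_eq (act_inj to g)) actKV.
Qed.

Lemma perm_sum_basis v : v = \sum_s ((v s *: (1 : A)) : A^c) *: basis s.
Proof.
apply/ffunP=> t; rewrite perm_sumE (bigD1 t) //= permZ_const ffunE eqxx mulr1.
rewrite big1 ?addr0 // => s /negPf nst.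
by rewrite permZ_const ffunE eq_sym nst mulr0.
Qed.

Lemma converseME (a c : A^c) g :
  ((a * c : A^c) : A) g = \sum_h (c : A) h * (a : A) (h^-1 * g)%g.
Proof. exact: (galgME (c : A) (a : A)). Qed.

Lemma app_basis X s t : app X (basis s) t = ent X s t.
Proof.
rewrite ffunE (bigD1 s) //= ffunE eqxx mul1r big1 ?addr0 // => u /negPf nus.
by rewrite ffunE nus mul0r.
Qed.

Lemma app_inj X Y : (forall v, app X v = app Y v) -> X = Y.
Proof. by move=> eqXY; apply: entP => s t; rewrite -!app_basis eqXY. Qed.

Lemma appM X Y v : app (X * Y) v = app Y (app X v).
Proof.
apply/ffunP=> t; rewrite !ffunE.
under eq_bigr do rewrite entM mulr_sumr.
rewrite exchange_big /=; apply: eq_bigr => u _; rewrite ffunE mulr_suml.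
by apply: eq_bigr => s _; rewrite mulrA.
Qed.

Lemma appBl X Y v : app (X - Y) v = app X v - app Y v.
Proof.
apply/ffunP=> t; rewrite !ffunE -sumrB.
by apply: eq_bigr => s _; rewrite entD entN mulrBr.
Qed.

Lemma app_sum (I : finType) (X : I -> 'M[O]_#|T|) v :
  app (\sum_i X i) v = \sum_i app (X i) v.
Proof.
apply/ffunP=> t; rewrite perm_sumE ffunE; under [RHS]eq_bigr do rewrite ffunE.
rewrite exchange_big /=; apply: eq_bigr => s _.
by rewrite ent_sum mulr_sumr.
Qed.

Lemma app0 v : app 0 v = 0.
Proof.
by apply/ffunP=> t; rewrite ffunE perm0E big1 // => s _; rewrite ent0 mulr0.
Qed.

Lemma app_mx1 v : app 1 v = v.
Proof.
apply/ffunP=> t; rewrite ffunE (bigD1 t) //= big1 ?addr0 => [|s /negPf nst].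
  by rewrite /ent mxE eqxx mulr1.
by rewrite /ent mxE (inj_eq enum_rank_inj) nst mulr0.
Qed.

Lemma app_linear X a u v : equivariant to X ->
  app X (a *: u + v) = a *: app X u + app X v.
Proof.
move=> eX; apply/ffunP=> t; rewrite permDE permZE !ffunE.
under eq_bigr do rewrite permDE permZE mulrDl mulr_suml.
rewrite big_split /=; congr (_ + _); rewrite exchange_big /=.
apply: eq_bigr => g _; rewrite ffunE mulr_sumr.
rewrite [RHS](reindex_inj (act_inj to g^-1%g)) /=.
by apply: eq_bigr => s _; rewrite eX mulrA.
Qed.

Lemma linear0f (W : lmodType A^c) (W' : lmodType A^c) (h : W -> W') :
  (forall a (u v : W), h (a *: u + v) = a *: h u + h v) -> h 0 = 0.
Proof.
move=> hL; have := hL (-1) 0 0; rewrite !scaleN1r oppr0 addr0 => ->.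
by rewrite addNr.
Qed.

Lemma linear_sumf (W : lmodType A^c) (W' : lmodType A^c) (h : W -> W')
    (I : finType) (c : I -> A^c) (F : I -> W) :
  (forall a (u v : W), h (a *: u + v) = a *: h u + h v) ->
  h (\sum_i c i *: F i) = \sum_i c i *: h (F i).
Proof.
move=> hL; have h0 := linear0f hL.
apply: (big_ind2 (fun x y => h x = y)) => //.
  by move=> x1 y1 x2 y2 <- <-; rewrite -[x1]scale1r hL !scale1r.
by move=> i _; rewrite -[_ *: F i]addr0 hL h0 addr0.
Qed.

Section LinearToMatrix.
Variable phi : V -> V.
Hypothesis phiL : forall a u v, phi (a *: u + v) = a *: phi u + phi v.

Definition mx_of : 'M[O]_#|T| := fun_mx (fun s t => phi (basis s) t).

Lemma app_mx_of v : app mx_of v = phi v.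
Proof.
rewrite {2}[v]perm_sum_basis linear_sumf //; apply/ffunP=> t.
rewrite perm_sumE ffunE; apply: eq_bigr => s _.
by rewrite permZ_const ent_fun_mx.
Qed.

Lemma mx_of_equivariant : equivariant to mx_of.
Proof.
move=> g s t; rewrite !ent_fun_mx -basis_act.
rewrite -[_ *: basis s]addr0 phiL (linear0f phiL) addr0.
by rewrite permZ_delta actK.
Qed.
End LinearToMatrix.

Definition mx_image X : set V := [set v | app X v = v].

Lemma mx_image_submodule X : equivariant to X -> submodule (mx_image X).
Proof.
move=> eX; apply/submoduleE; split=> [|a u v Xu Xv]; rewrite /mx_image /=.
  by apply: (@linear0f V V) => a u v; exact: app_linear.
by rewrite app_linear // Xu Xv.
Qed.

(** A factorisation of [X] through a free module writes [X] as a trace, since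
    the identity of the regular module is the trace of the projection to the
    coefficient at the identity. *)
Lemma projective_mx_image X : equivariant to X -> X * X = X ->
  projective (mx_image X) -> exists f, X = mxtr to f.
Proof.
move=> eX XX [n [F [F' [[sF sF' FF' sumF] [phi [phiF phi_inj phi_surj] phiL]]]]].
have /submoduleE[F0 FL] := sF; have /submoduleE[F'0 F'L] := sF'.
have appXL := app_linear _ _ _ eX.
have imX v : mx_image X (app X v) by rewrite /mx_image /= -appM XX.
have /submoduleE[im0 imL] := mx_image_submodule eX.
(* [psi] is the projection to [F] along [F'] followed by the inverse of [phi]. *)
have psi_ex (w : 'rV[A^c]_n) : exists v, mx_image X v /\ F' (w - phi v).
  have : setT w by []; rewrite sumF => -[w1 Fw1 [w2 F'w2 <-]].
  have [v imv <-] := phi_surj _ Fw1; exists v; split=> //.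
  by rewrite addrC addKr.
pose psi w := projT1 (cid (psi_ex w)).
have psi_im w : mx_image X (psi w) by rewrite /psi; case: cid => v [].
have psiP w : F' (w - phi (psi w)) by rewrite /psi; case: cid => v [].
have psi_uniq w v : mx_image X v -> F' (w - phi v) -> psi w = v.
  move=> imv F'v; apply: phi_inj; rewrite ?inE //.
  apply/eqP; rewrite -subr_eq0; apply/eqP.
  have : (F `&` F') (phi (psi w) - phi v).
    split.
      rewrite addrC -scaleN1r; apply: FL; apply: phiF => //; exact: psi_im.
    have -> : phi (psi w) - phi v = -1 *: (w - phi (psi w)) + (w - phi v).
      by rewrite scaleN1r opprB subrKA.
    exact: F'L.
  by rewrite FF'.
have psiL a (u v : 'rV[A^c]_n) : psi (a *: u + v) = a *: psi u + psi v.
  apply: psi_uniq; first exact: imL.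
  rewrite phiL // opprD addrACA -scalerN -scalerDr; exact: F'L.
have psi_phi v : mx_image X v -> psi (phi v) = v.
  by move=> imv; apply: psi_uniq => //; rewrite subrr.
pose h v := phi (app X v).
have hL a u v : h (a *: u + v) = a *: h u + h v.
  by rewrite /h appXL phiL.
exists (fun_mx (fun s t => \sum_j (h (basis s) 0 j : A) 1%g * psi (delta_mx 0 j) t)).
apply: entP => s t; rewrite -app_basis -(psi_phi (app X (basis s))) // -/(h _).
rewrite {1}[h _]row_sum_delta linear_sumf // perm_sumE ent_fun_mx.
under eq_bigr do rewrite permZE.
rewrite exchange_big (reindex_inj invg_inj) /=; apply: eq_bigr => g _.
rewrite ent_fun_mx; apply: eq_bigr => j _; rewrite invgK -basis_act.
rewrite -[_ *: basis s]addr0 hL (linear0f hL) addr0 mxE; congr (_ * _).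
rewrite -[RHS]/(((h (basis s) 0 j : A) * delta O g) 1%g).
by rewrite deltaMr mul1g.
Qed.

(** The trace of [f] factors through a free module: [alpha] records the images
    under [f] of all translates of a vector, and [beta] translates them back
    and adds them up. *)
Lemma mxtr_projective X f : X = mxtr to f -> X * X = X ->
  projective (mx_image X).
Proof.
move=> defX XX; have eX : equivariant to X by rewrite defX; exact: mxtr_equivariant.
have appXL := app_linear _ _ _ eX.
pose alpha v : 'rV[A^c]_#|T| :=
  \row_j ([ffun g => \sum_s v (to s g) * ent f s (enum_val j)] : A).
pose beta (w : 'rV[A^c]_#|T|) : V := \sum_j w 0 j *: basis (enum_val j).
have alphaL c u v : alpha (c *: u + v) = c *: alpha u + alpha v.
  apply/rowP=> j; rewrite !mxE; apply/ffunP=> g.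
  rewrite [RHS]galgDE [X in _ = X + _]converseME !ffunE.
  under eq_bigr do rewrite permDE mulrDl permZE mulr_suml.
  rewrite big_split /=; congr (_ + _); rewrite exchange_big /=.
  rewrite [RHS](reindex_inj invg_inj) [RHS](reindex_inj (mulIg g^-1%g)) /=.
  apply: eq_bigr => h _; rewrite ffunE invgK mulgKV invMg invgK mulr_suml.
  by apply: eq_bigr => s _; rewrite actM -mulrA mulrC.
have betaL c (u v : 'rV[A^c]_#|T|) : beta (c *: u + v) = c *: beta u + beta v.
  rewrite /beta scaler_sumr -big_split /=; apply: eq_bigr => j _.
  by rewrite !mxE scalerDl scalerA.
have entX s t : ent X s t = \sum_g ent f (to s g) (to t g).
  by rewrite defX ent_fun_mx.
have beta_alpha v : beta (alpha v) = app X v.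
  apply/ffunP=> r; rewrite perm_sumE ffunE.
  under eq_bigr do rewrite mxE permZE.
  under [RHS]eq_bigr do rewrite entX mulr_sumr.
  rewrite exchange_big [RHS]exchange_big /= [RHS](reindex_inj invg_inj) /=.
  apply: eq_bigr => g _.
  rewrite (sum_enum_val (fun t => ([ffun g => \sum_s v (to s g) * ent f s t] : A) g
    * basis t (to r g^-1%g))).
  rewrite (bigD1 (to r g^-1%g)) //= !ffunE eqxx mulr1.
  rewrite [X in _ + X]big1 ?addr0 => [|t].
    rewrite [RHS](reindex_inj (act_inj to g)) /=.
    by apply: eq_bigr => s _; rewrite actK.
  by rewrite !ffunE eq_sym => /negPf ->; rewrite mulr0.
pose P w := alpha (app X (beta w)).
have PL c (u v : 'rV[A^c]_#|T|) : P (c *: u + v) = c *: P u + P v.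
  by rewrite /P betaL appXL alphaL.
have PP w : P (P w) = P w.
  by rewrite /P beta_alpha -!appM !XX.
have P0 : P 0 = 0 by exact: (@linear0f 'rV[A^c]_#|T| 'rV[A^c]_#|T|).
exists #|T|, [set w | P w = w], [set w | P w = 0]; split.
  split.
  - by apply/submoduleE; split=> //= a u v Pu Pv; rewrite PL Pu Pv.
  - by apply/submoduleE; split=> //= a u v Pu Pv; rewrite PL Pu Pv scaler0 addr0.
  - by apply/seteqP; split=> w /=; [case=> -> |move=> ->].
  apply/seteqP; split=> // w _; exists (P w); first exact: PP.
  exists (- P w + w); last by rewrite addrA subrr add0r.
  by rewrite /= -scaleN1r PL PP scaleN1r addNr.
exists alpha => [|c u v _ _]; last exact: alphaL.
split=> [v imv|u v|w /= Pw].
- by rewrite /= /P beta_alpha imv imv.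
- by rewrite !inE => imu imv eq_a; rewrite -imu -imv -!beta_alpha eq_a.
exists (app X (beta w)) => //.
by rewrite /mx_image /= -appM XX.
Qed.
End PermutationEndomorphisms.

(** * The correspondence *)

Section Decomposition.
Variables (O : comNzRingType) (gT : finGroupType) (T : finType).
Variable to : {action gT &-> T}.
Local Notation A := (galg O gT).
Local Notation V := (permmod O to).

(** A splitting of the idempotent [X] splits its image. *)
Lemma prim_idem_image (X : 'M[O]_#|T|) : equivariant to X -> X * X = X ->
  indecomposable (@mx_image O gT T to X) -> prim_idem to X.
Proof.
move=> eX XX [_ imn0 ind]; split=> // [X0|Y eY YY XY YX].
  apply: imn0; rewrite X0; apply/seteqP; split=> v; rewrite /mx_image /=.
    by rewrite app0 => <-.
  by rewrite app0 => ->.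
have eXY : equivariant to (X - Y) by exact: equivariantB.
have im0 (Z : 'M[O]_#|T|) : Z * Z = Z -> @mx_image O gT T to Z = [set 0] -> Z = 0.
  move=> ZZ Z0; apply: (@app_inj O gT T to) => v; rewrite app0.
  have : @mx_image O gT T to Z (app Z v) by rewrite /mx_image /= -appM ZZ.
  by rewrite Z0.
have XYXY : (X - Y) * (X - Y) = X - Y.
  by rewrite mulrBl !mulrBr XX XY YX YY subrr subr0.
have [] := ind (@mx_image O gT T to Y) (@mx_image O gT T to (X - Y)).
- split; [exact: mx_image_submodule|exact: mx_image_submodule| |].
    apply/seteqP; split=> v; rewrite /mx_image /=; last first.
      by move=> ->; split; apply: (@linear0f O gT V V) => a u v0;
        exact: app_linear.
    by move=> [<-]; rewrite -appM mulrBr YX YY subrr app0.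
  apply/seteqP; split=> v; rewrite /mx_image /=.
    move=> Xv; exists (app Y v); first by rewrite /= -appM YY.
    exists (app (X - Y) v); first by rewrite /= -appM XYXY.
    by rewrite appBl Xv addrC subrK.
  move=> [u Yu [w XYw <-]]; have XXY : (X - Y) * X = X - Y by rewrite mulrBl XX YX.
  have Xu : app X u = u by rewrite -{1}Yu -appM YX Yu.
  have Xw : app X w = w by rewrite -{1}XYw -appM XXY XYw.
  by have := app_linear 1 u w eX; rewrite !scale1r Xu Xw.
- by move=> /(im0 _ YY); left.
by move=> /(im0 _ XYXY)/eqP; rewrite subr_eq0 => /eqP; right.
Qed.

(** Uniqueness of the components makes the projections linear. *)
Lemma indec_decomposition_mx (I : finType) (M : I -> set V) :
    indec_decomposition M ->
  exists E : I -> 'M[O]_#|T|,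
    [/\ forall i, M i = @mx_image O gT T to (E i), forall i, prim_idem to (E i),
        forall i j, i != j -> E i * E j = 0 & \sum_i E i = 1].
Proof.
move=> [indM decM]; pose x v := projT1 (cid (decM v)).
have xP v : (forall i, M i (x v i)) /\ v = \sum_i x v i.
  by rewrite /x; case: cid => y [].
have x_uniq v (y : {ffun I -> V}) :
    (forall i, M i (y i)) -> v = \sum_i y i -> x v = y.
  by move=> My vy; rewrite /x; case: cid => z [_] /=; apply.
have ML i : M i 0 /\ forall a u v, M i u -> M i v -> M i (a *: u + v).
  by apply/submoduleE; have [] := indM i.
have xL i a u v : x (a *: u + v) i = a *: x u i + x v i.
  rewrite (x_uniq _ [ffun i => a *: x u i + x v i]) ?ffunE // => [j|].
    by rewrite ffunE; apply: (ML j).2; [exact: (xP u).1|exact: (xP v).1].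
  under eq_bigr do rewrite ffunE.
  by rewrite big_split /= -scaler_sumr -(xP u).2 -(xP v).2.
pose E i := mx_of (fun v => x v i).
have appE i v : app (E i) v = x v i by apply: app_mx_of => a u w; exact: xL.
have eE i : equivariant to (E i).
  by apply: mx_of_equivariant => a u w; exact: xL.
have x_in i v : M i v -> x v = [ffun j => if j == i then v else 0].
  move=> Miv; apply: x_uniq => [j|].
    by rewrite ffunE; case: eqP => [->|_] //; exact: (ML j).1.
  rewrite (bigD1 i) //= ffunE eqxx big1 ?addr0 // => j /negPf nji.
  by rewrite ffunE nji.
have imE i : M i = @mx_image O gT T to (E i).
  apply/seteqP; split=> v; rewrite /mx_image /= appE.
    by move=> /x_in ->; rewrite ffunE eqxx.
  by move=> <-; exact: (xP v).1.
have EE i : E i * E i = E i.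
  apply: (@app_inj O gT T to) => v; rewrite appM.
  have : M i (app (E i) v) by rewrite appE; exact: (xP v).1.
  by rewrite {1}imE.
exists E; split=> // [i|i j nij|].
- by apply: prim_idem_image; rewrite -?imE.
- apply: (@app_inj O gT T to) => v; rewrite appM app0 !appE.
  by rewrite (x_in i) ?ffunE ?[j == i]eq_sym ?(negPf nij) //; exact: (xP v).1.
apply: (@app_inj O gT T to) => v; rewrite app_sum app_mx1.
by under eq_bigr do rewrite appE; rewrite -(xP v).2.
Qed.
End Decomposition.

Section Correspondence.
Variables (O : comUnitRingType) (k : closedFieldType) (red : {rmorphism O -> k}).
Hypothesis k2 : 2%N \in [pchar k].
Hypothesis red_surj : forall y, exists x, red x = y.
Hypothesis red_unit : forall x, red x \is a GRing.unit -> x \is a GRing.unit.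
Hypothesis idem_lift : forall n (B : 'M[O]_n),
  map_mx red (B *m B) = map_mx red B ->
  exists E : 'M[O]_n, [/\ E *m E = E, map_mx red E = map_mx red B &
    forall P, P *m B = B *m P -> P *m E = E *m P].

Theorem real_defect0_bij (gT : finGroupType) (I : finType)
    (M : I -> set (permmod O (Omega_action gT))) : indec_decomposition M ->
  exists f : I -> set (galg O gT),
    set_bij [set i | projective (M i)]
      [set B | real_block B /\ simple_alg (galg_map red @` B)] f.
Proof.
move=> /indec_decomposition_mx[E [imE primE orthE sumE]].
pose rd := @galg_map O k gT red.
pose corr i B := exists e, [/\ block_idem e, galg_inv e = e, B = corner e,
  simple_alg (corner (rd e)) & map_mx red (E i) = rho (rd e)].
have primrE i : prim_idem (Omega_action gT) (map_mx red (E i)).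
  exact: prim_idem_red.
have projE i : projective (M i) <-> exists f, E i = mxtr (Omega_action gT) f.
  have [eE EE _ _] := primE i; rewrite imE.
  by split=> [|[f]]; [exact: projective_mx_image|move/mxtr_projective; apply].
have corr_ex i : projective (M i) -> exists B, corr i B.
  move=> /projE[f defE].
  have [||u [bu su simple_u defr]] :=
    @prim_mxtr_rho k gT k2 (map_mx red (E i)) (map_mx red f).
  - exact: primrE.
  - by rewrite defE mxtr_red.
  have [e [be redu]] := block_idem_lift red_surj red_unit idem_lift bu.
  exists (corner e), e; split; rewrite /rd ?redu //.
  have [cie _ _] := be; apply: (central_idem_red_inj red_unit) => //.
    exact: central_idem_inv.
  by rewrite galg_map_inv redu.
have corr_orth i B j B' : corr i B -> corr j B' -> B = B' <-> i = j.
  move=> [e [be se -> simple_e ei]] [c [bc sc -> simple_c cj]].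
  have [cie _ _] := be; have [cic _ _] := bc.
  have bu := block_idem_red red_surj red_unit idem_lift be.
  have bu' := block_idem_red red_surj red_unit idem_lift bc.
  have su : galg_inv (rd e) = rd e by rewrite -galg_map_inv se.
  have su' : galg_inv (rd c) = rd c by rewrite -galg_map_inv sc.
  have rho_n0 : rho (rd e) <> 0.
    by apply: rho_neq0 => //; exact: central_idem_red.
  split=> [/(corner_inj cie cic) eqec|eqij].
    apply: contrapT => /eqP nij; apply: rho_n0.
    have := congr1 (map_mx red) (orthE i j nij).
    rewrite red_mxM ei cj -eqec map_mx0 -(rhoM k2) //; last 2 first.
    - by have [[]] := bu.
    - by have [[]] := bu.
    by have [[_ ->]] := bu.
  congr corner; apply: (central_idem_red_inj red_unit) => //.
  case: (block_idem_orth bu bu') => // ec0; case: rho_n0.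
  have [[cu uu] _ _] := bu; have [[cu' _] _ _] := bu'.
  have : rho (rd e) * rho (rd c) = 0 by rewrite -(rhoM k2) // ec0 rho0.
  by rewrite -cj -eqij ei -(rhoM k2) // (uu : rd e * rd e = rd e).
pose f i := if pselect (exists B, corr i B) is left h
            then projT1 (cid h) else set0.
have fP i : projective (M i) -> corr i (f i).
  move=> /corr_ex Bi; rewrite /f; case: pselect => // h.
  by case: cid.
exists f; split=> [i /= pi|i j|B /= [[]]].
- have [e [be se -> simple_e _]] := fP i pi; have [cie _ _] := be.
  split; last by rewrite corner_red.
  by split; [apply/blockP; exists e|apply/real_corner].
- rewrite !inE /= => pi pj eqf.
  exact: (corr_orth _ _ _ _ (fP i pi) (fP j pj)).1.
move=> /blockP[e be ->]; have [cie _ _] := be => /(real_corner cie) se.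
rewrite corner_red // => simple_e; have ciu := central_idem_red red cie.
have su : galg_inv (rd e) = rd e by rewrite -galg_map_inv se.
have rho_n0 : rho (rd e) <> 0 by exact: rho_neq0.
have [i rEi] : exists i, rho (rd e) * map_mx red (E i) <> 0.
  apply: contrapT => nE; apply: rho_n0.
  have -> : rho (rd e) = rho (rd e) * map_mx red (\sum_i E i).
    by rewrite sumE map_mx1 mulr1.
  rewrite map_mx_sum mulr_sumr big1 // => i _.
  by apply: contrapT => nEi; apply: nE; exists i.
have defEi := rho_simple_prim k2 ciu su simple_e (primrE i) rEi.
have matchB : corr i (corner e) by exists e.
have [x ex] := simple_trG ciu simple_e.
have [f0 ef0] := rho_mxtr k2 ciu su ex.
have pi : projective (M i).
  apply/projE; have [eE EE _ _] := primE i.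
  by apply: (mxtr_red_lift red_surj red_unit) => //; rewrite defEi ef0.
exists i => //; exact: (corr_orth _ _ _ _ (fP i pi) matchB).2.
Qed.
End Correspondence.

Theorem corollary9
  (k : closedFieldType) (k_char2 : 2%N \in [pchar k])
  (R : idomainType) (R_dvr : is_dvr R) (R_complete : is_complete R)
  (R_char0 : [pchar R] =i pred0)
  (red : {rmorphism R -> k}) (red_surj : forall y, exists x, red x = y)
  (red_ker : forall x, red x = 0 <-> x \isn't a GRing.unit)
  (gT : finGroupType) (F_split : group_closure_field {fraction R} gT) :
  (forall (I : finType) (M : I -> set (permmod k (Omega_action gT))),
     indec_decomposition M ->
     exists f : I -> set (galg k gT),
       set_bij [set i | projective (M i)]
               [set B | real_block B /\ defect0_field B] f)
  /\
  (forall (I : finType) (M : I -> set (permmod R (Omega_action gT))),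
     indec_decomposition M ->
     exists f : I -> set (galg R gT),
       set_bij [set i | projective (M i)]
               [set B | real_block B /\ defect0_lift red B] f).
Proof.
split=> I M decM; last first.
  apply: (real_defect0_bij k_char2 red_surj) decM => [x|].
    rewrite unitfE; apply: contraR => nux; apply/eqP; exact/red_ker.
  exact: dvr_idem_lift.
have [|x|n B|f bij_f] :=
    @real_defect0_bij k k (idfun : {rmorphism k -> k}) k_char2 _ _ _ gT I M decM.
- by move=> y; exists y.
- by [].
- by rewrite !map_mx_id // => BB; exists B; split; rewrite ?map_mx_id.
exists f; suff -> : [set B : set (galg k gT) | real_block B /\ defect0_field B] =
    [set B | real_block B /\ simple_alg (galg_map (@idfun k) @` B)] by [].
have map_id (B : set (galg k gT)) : galg_map (@idfun k) @` B = B.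
  have idE (x : galg k gT) : galg_map (@idfun k) x = x.
    by apply/ffunP=> g; rewrite ffunE.
  by apply/seteqP; split=> x /= => [[y By <-]|Bx]; [rewrite idE|exists x].
by apply/seteqP; split=> B /=; rewrite map_id.
Qed.
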